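(* Let $D=\left(\frac{a,\pi}{K}\right)$ be a quaternion division algebra over $K$ with $a\in\mathcal{O}_K^*$, with $K$-basis $1,x,y,z$ where $x^2=a$, $y^2=\pi$, $z=xy=-yx$, and let $\tau$ be its canonical involution. Take $\epsilon=-1$, $\sigma=\tau_y$ and $\pi'=y$, so that $\sigma_{\pi'}=\tau$ and $\overline{\sigma_{\pi'}}=\iota$. Then every skew-hermitian form over $(D,\tau_y)$ is ramified, Larmour's isomorphism is an isomorphism $$\partial_1: W^{-1}\left(\left(\tfrac{a,\pi}{K}\right),\tau_y\right)\cong W^{1}(k(\overline x),\iota),$$ any one-dimensional skew-hermitian form over $(D,\tau_y)$ can be diagonalized as $\langle\beta y\rangle$ with $\beta\in\mathcal{O}_K^*$, and the image of $\langle\beta y\rangle$ under $\partial_1$ is the hermitian form $\langle\overline\beta\rangle$ over $(k(\overline x),\iota)$.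
   Context: $K$ is a complete discretely valued field with normalized valuation $\nu_K$, valuation ring $\mathcal{O}_K$, uniformizer $\pi$ and residue field $k$ of characteristic $\neq2$. $\nu_D(d)=\frac12\nu_K(\mathrm{Nrd}(d))$ extends $\nu_K$ to $D$; $\mathcal{O}_D=\{\nu_D\ge0\}$, $m_D=\{\nu_D>0\}$ (both with $0$), $\overline D=\mathcal{O}_D/m_D$, and a bar denotes reduction modulo $m_D$. Here $\nu_D$ has value group $\frac12\mathbb{Z}$ and $\overline D\cong k(\overline x)$, a quadratic field extension of $k$ with $\overline x^2=\overline a$; $\iota$ is its nontrivial $k$-automorphism. Every $K$-linear involution $\sigma$ of $D$ induces an involution $\overline\sigma$ on $\overline D$. $\tau(x)=-x$, $\tau(y)=-y$, $\tau(z)=-z$, and $\overline\tau=\iota$. For $\lambda\in D^*$, $\sigma_\lambda(d)=\lambda\sigma(d)\lambda^{-1}$; one has $\overline{\tau_y}=\mathrm{id}$. $W^\epsilon(E,\rho)$ is the Witt group of nondegenerate $\epsilon$-hermitian forms over a division algebra with involution $(E,\rho)$ (skew-hermitian means $\epsilon=-1$), and $\langle u_1,\dots,u_r\rangle$ is the diagonal form with $\rho(u_i)=\epsilon u_i$. Larmour's isomorphism: given an $\epsilon$-symmetric uniformizer $\pi'$ of $D$ (i.e. $\sigma(\pi')=\epsilon\pi'$ and $\nu_D(\pi')=\frac12$), every $\epsilon$-hermitian form over $(D,\sigma)$ is isometric to $h_0\perp h_1$ with $h_0=\langle u_1,\dots,u_p\rangle$, $\nu_D(u_i)=0$, and $h_1=\langle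 v_1,\dots,v_q\rangle$, $\nu_D(v_i)=\frac12$. A form isometric to such an $h_1$ is called ramified. Set $\overline{h_0}=\langle\overline{u_1},\dots,\overline{u_p}\rangle$ and $\overline{h_1}=\langle\overline{v_1\pi'^{-1}},\dots,\overline{v_q\pi'^{-1}}\rangle$. Then $(\partial_0,\partial_1):W^\epsilon(D,\sigma)\to W^\epsilon(\overline D,\overline\sigma)\oplus W^1(\overline D,\overline{\sigma_{\pi'}})$, $[h]\mapsto([\overline{h_0}],[\overline{h_1}])$, is Larmour's (well-defined) group isomorphism; when $W^\epsilon(\overline D,\overline\sigma)=0$ it reduces to $\partial_1$. *)

(* Defs.v *)
From HB Require Import structures.
From mathcomp Require Import all_boot all_order all_algebra all_field.
From mathcomp Require Import boolp.
From mathcomp Require Import ring.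

Set Implicit Arguments.
Unset Strict Implicit.
Unset Printing Implicit Defensive.

Import Order.TTheory GRing.Theory Num.Theory.
Local Open Scope ring_scope.

(* [Quat t0 t1 t2 t3] is t0 + t1 x + t2 y + t3 z, where x^2 = a, y^2 = b and
   z = xy = -yx. *)
Record quaternion (K : Type) (a b : K) := Quat { qc0 : K; qc1 : K; qc2 : K; qc3 : K }.

Section QuaternionChoice.
Variables (K : choiceType) (a b : K).
Definition quat_enc (p : quaternion a b) := (qc0 p, qc1 p, qc2 p, qc3 p).
Definition quat_dec (t : K * K * K * K) : quaternion a b :=
  let: (t0, t1, t2, t3) := t in Quat a b t0 t1 t2 t3.
Lemma quat_encK : cancel quat_enc quat_dec. Proof. by case. Qed.
HB.instance Definition _ := Choice.copy (quaternion a b) (can_type quat_encK).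
End QuaternionChoice.

Section QuaternionAlgebra.
Variables (K : fieldType) (a b : K).
Local Notation Q := (quaternion a b).

Definition quat_add (p q : Q) : Q :=
  Quat a b (qc0 p + qc0 q) (qc1 p + qc1 q) (qc2 p + qc2 q) (qc3 p + qc3 q).
Definition quat_opp (p : Q) : Q := Quat a b (- qc0 p) (- qc1 p) (- qc2 p) (- qc3 p).
Definition quat_mul (p q : Q) : Q :=
  let: Quat p0 p1 p2 p3 := p in let: Quat q0 q1 q2 q3 := q in
  Quat a b (p0 * q0 + a * (p1 * q1) + b * (p2 * q2) - a * b * (p3 * q3))
           (p0 * q1 + p1 * q0 - b * (p2 * q3) + b * (p3 * q2))
           (p0 * q2 + p2 * q0 + a * (p1 * q3) - a * (p3 * q1))
           (p0 * q3 + p3 * q0 + p1 * q2 - p2 * q1).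
Definition quat_scale (c : K) (p : Q) : Q :=
  Quat a b (c * qc0 p) (c * qc1 p) (c * qc2 p) (c * qc3 p).

Lemma addqA : associative quat_add.
Proof. by move=> [????] [????] [????]; rewrite /quat_add /=; congr Quat; ring. Qed.
Lemma addqC : commutative quat_add.
Proof. by move=> [????] [????]; rewrite /quat_add /=; congr Quat; ring. Qed.
Lemma add0q : left_id (Quat a b 0 0 0 0) quat_add.
Proof. by move=> [????]; rewrite /quat_add /=; congr Quat; ring. Qed.
Lemma addNq : left_inverse (Quat a b 0 0 0 0) quat_opp quat_add.
Proof. by move=> [????]; rewrite /quat_add /=; congr Quat; ring. Qed.
HB.instance Definition _ := GRing.isZmodule.Build Q addqA addqC add0q addNq.

Lemma mulqA : associative quat_mul.
Proof. by move=> [????] [????] [????]; rewrite /quat_mul /=; congr Quat; ring. Qed.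
Lemma mul1q : left_id (Quat a b 1 0 0 0) quat_mul.
Proof. by move=> [????]; rewrite /quat_mul /=; congr Quat; ring. Qed.
Lemma mulq1 : right_id (Quat a b 1 0 0 0) quat_mul.
Proof. by move=> [????]; rewrite /quat_mul /=; congr Quat; ring. Qed.
Lemma mulqDl : left_distributive quat_mul quat_add.
Proof. by move=> [????] [????] [????]; rewrite /quat_mul /quat_add /=; congr Quat; ring. Qed.
Lemma mulqDr : right_distributive quat_mul quat_add.
Proof. by move=> [????] [????] [????]; rewrite /quat_mul /quat_add /=; congr Quat; ring. Qed.
Lemma oneq_neq0 : Quat a b 1 0 0 0 != 0.
Proof. by apply/eqP => -[] /eqP; rewrite oner_eq0. Qed.
HB.instance Definition _ :=
  GRing.Zmodule_isNzRing.Build Q mulqA mul1q mulq1 mulqDl mulqDr oneq_neq0.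

Lemma scaleqA (c d : K) (p : Q) : quat_scale c (quat_scale d p) = quat_scale (c * d) p.
Proof. by case: p => ????; rewrite /quat_scale /=; congr Quat; ring. Qed.
Lemma scale1q : left_id 1 quat_scale.
Proof. by move=> [????]; rewrite /quat_scale /=; congr Quat; ring. Qed.
Lemma scaleqDr : right_distributive quat_scale quat_add.
Proof. by move=> c [????] [????]; rewrite /quat_scale /quat_add /=; congr Quat; ring. Qed.
Lemma scaleqDl (p : Q) : {morph quat_scale^~ p : c d / c + d >-> quat_add c d}.
Proof. by case: p => ???? c d; rewrite /quat_scale /quat_add /=; congr Quat; ring. Qed.
HB.instance Definition _ :=
  GRing.Zmodule_isLmodule.Build K Q scaleqA scale1q scaleqDr scaleqDl.

Lemma scaleqAl (c : K) (p q : Q) : quat_scale c (quat_mul p q) = quat_mul (quat_scale c p) q.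
Proof. by case: p => ????; case: q => ????; rewrite /quat_scale /=; congr Quat; ring. Qed.
HB.instance Definition _ := GRing.Lmodule_isLalgebra.Build K Q scaleqAl.

Lemma scaleqAr (c : K) (p q : Q) : quat_scale c (quat_mul p q) = quat_mul p (quat_scale c q).
Proof. by case: p => ????; case: q => ????; rewrite /quat_scale /=; congr Quat; ring. Qed.
HB.instance Definition _ := GRing.Lalgebra_isAlgebra.Build K Q scaleqAr.

Definition qx : Q := Quat a b 0 1 0 0.
Definition qy : Q := Quat a b 0 0 1 0.
Definition qz : Q := Quat a b 0 0 0 1.

Lemma addqE (p q : Q) : p + q = quat_add p q. Proof. by []. Qed.
Lemma oppqE (p : Q) : - p = quat_opp p. Proof. by []. Qed.
Lemma mulqE (p q : Q) : p * q = quat_mul p q. Proof. by []. Qed.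
Lemma scaleqE (c : K) (p : Q) : c *: p = quat_scale c p. Proof. by []. Qed.
Lemma oneqE : 1 = Quat a b 1 0 0 0. Proof. by []. Qed.
Definition quatopE := (addqE, oppqE, mulqE, scaleqE, oneqE).

Lemma quatE (p : Q) : p = qc0 p *: 1 + qc1 p *: qx + qc2 p *: qy + qc3 p *: qz.
Proof. by case: p => ????; rewrite !quatopE /quat_add /quat_scale /=; congr Quat; ring. Qed.
Lemma qxx : qx * qx = a *: 1.
Proof. by rewrite !quatopE /quat_scale /=; congr Quat; ring. Qed.
Lemma qyy : qy * qy = b *: 1.
Proof. by rewrite !quatopE /quat_scale /=; congr Quat; ring. Qed.
Lemma qxy : qx * qy = qz.
Proof. by rewrite !quatopE /qz /=; congr Quat; ring. Qed.
Lemma qyx : qy * qx = - qz.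
Proof. by rewrite !quatopE /quat_opp /=; congr Quat; ring. Qed.

Definition conjq (p : Q) : Q := Quat a b (qc0 p) (- qc1 p) (- qc2 p) (- qc3 p).

Definition Nrd (p : Q) : K :=
  qc0 p ^+ 2 - a * qc1 p ^+ 2 - b * qc2 p ^+ 2 + a * b * qc3 p ^+ 2.

Lemma mulq_conj (p : Q) : p * conjq p = Nrd p *: 1.
Proof. by case: p => ????; rewrite !quatopE /quat_scale /Nrd /=; congr Quat; ring. Qed.
Lemma conj_mulq (p : Q) : conjq p * p = Nrd p *: 1.
Proof. by case: p => ????; rewrite !quatopE /quat_scale /Nrd /=; congr Quat; ring. Qed.
Lemma NrdM (p q : Q) : Nrd (p * q) = Nrd p * Nrd q.
Proof. by case: p => ????; case: q => ????; rewrite mulqE /Nrd /=; ring. Qed.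
Lemma Nrd1 : Nrd 1 = 1.
Proof. by rewrite oneqE /Nrd /=; ring. Qed.

Definition quat_unit : pred Q := fun p => Nrd p != 0.
Definition quat_inv (p : Q) : Q := if quat_unit p then (Nrd p)^-1 *: conjq p else p.

Lemma mulVq : {in quat_unit, left_inverse 1 quat_inv *%R}.
Proof.
move=> p; rewrite unfold_in => up.
by rewrite /quat_inv /quat_unit up -scalerAl conj_mulq scalerA mulVf // scale1r.
Qed.
Lemma mulqV : {in quat_unit, right_inverse 1 quat_inv *%R}.
Proof.
move=> p; rewrite unfold_in => up.
by rewrite /quat_inv /quat_unit up -scalerAr mulq_conj scalerA mulVf // scale1r.
Qed.
Lemma unitqP (p q : Q) : q * p = 1 /\ p * q = 1 -> quat_unit p.
Proof.
case=> _ /(congr1 Nrd); rewrite NrdM Nrd1 /quat_unit => e; apply/eqP => p0.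
by move/eqP: e; rewrite p0 mul0r eq_sym oner_eq0.
Qed.
Lemma invq_out : {in [predC quat_unit], quat_inv =1 id}.
Proof. by move=> p; rewrite !inE /= -topredE /= /quat_inv => /negPf ->. Qed.
HB.instance Definition _ :=
  GRing.NzRing_hasMulInverse.Build Q mulVq mulqV unitqP invq_out.

End QuaternionAlgebra.

Definition is_division_ring (D : unitRingType) := forall d : D, d != 0 -> d \is a GRing.unit.

Record involution (E : nzRingType) := Involution {
  invol_fun :> E -> E;
  involD : {morph invol_fun : u v / u + v};
  involM : forall u v, invol_fun (u * v) = invol_fun v * invol_fun u;
  involK : involutive invol_fun
}.

Section CanonicalInvolution.
Variables (K : fieldType) (a b : K).
Lemma conjqD : {morph @conjq K a b : u v / u + v}.
Proof. by move=> [????] [????]; rewrite !quatopE /quat_add /conjq /=; congr Quat; ring. Qed.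
Lemma conjqM (u v : quaternion a b) : conjq (u * v) = conjq v * conjq u.
Proof.
by case: u => ????; case: v => ????; rewrite !quatopE /conjq /=; congr Quat; ring.
Qed.
Lemma conjqK : involutive (@conjq K a b).
Proof. by move=> [????]; rewrite /conjq /=; congr Quat; ring. Qed.
Definition canonical_involution : involution (quaternion a b) :=
  Involution conjqD conjqM conjqK.
End CanonicalInvolution.

Section IdInvolution.
Variable E : comNzRingType.
Lemma id_invM (u v : E) : idfun (u * v) = idfun v * idfun u.
Proof. exact: mulrC. Qed.
Lemma id_invD : {morph (@idfun E) : u v / u + v}. Proof. by []. Qed.
Lemma id_invK : involutive (@idfun E). Proof. by []. Qed.
Definition id_involution : involution E := Involution id_invD id_invM id_invK.
End IdInvolution.

Definition conj_by (D : unitRingType) (lam : D) (s : D -> D) (d : D) : D :=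
  lam * s d * lam^-1.

(* The form on the left vector space 'rV[E]_n with Gram matrix H is
   h(v, w) = v *m H *m adjmx rho w, hence h(c v, d w) = c h(v, w) rho(d).
   Following mathcomp's sesquilinear forms, the sign is epsilon = (-1) ^+ eps for
   eps : bool; so eps = false means hermitian and eps = true skew-hermitian. *)
Section Forms.
Variables (E : nzRingType) (rho : involution E) (eps : bool).

Definition adjmx m n (A : 'M[E]_(m, n)) : 'M[E]_(n, m) := map_mx rho A^T.

Definition invertible_mx m n (P : 'M[E]_(m, n)) :=
  exists Q : 'M[E]_(n, m), P *m Q = 1%:M /\ Q *m P = 1%:M.

Definition gram := {n : nat & 'M[E]_n}.

Definition congruent m n (A : 'M[E]_m) (B : 'M[E]_n) :=
  exists2 P : 'M[E]_(m, n), invertible_mx P & P *m B *m adjmx P = A.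

Definition sumg (F G : gram) : gram :=
  Tagged (fun n => 'M[E]_n) (block_mx (tagged F) 0 0 (tagged G)).

Definition diagg (s : seq E) : gram :=
  Tagged (fun n => 'M[E]_n) (diag_mx (\row_(i < size s) s`_i)).

(* The adjoint map of the form is bijective iff its Gram matrix is invertible. *)
Definition form_axiom (F : gram) :=
  adjmx (tagged F) = (-1) ^+ eps *: tagged F /\ invertible_mx (tagged F).

Record epsform := Form { form_gram :> {n : nat & 'M[E]_n}; _ : `[< form_axiom form_gram >] }.
HB.instance Definition _ := [isSub for form_gram].
HB.instance Definition _ := [Choice of epsform by <:].

Definition form_dim (f : epsform) : nat := tag f.

Definition isometric (f g : epsform) := congruent (tagged f) (tagged g).

(* There is a totally isotropic direct summand of half the dimension.  When 2 is
   invertible in E this is the same as being hyperbolic. *)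
Definition metabolic (f : epsform) :=
  exists (n : nat) (A B C : 'M[E]_n), congruent (tagged f) (block_mx 0 A B C).

Lemma invol0 : rho 0 = 0.
Proof. by apply: (addrI (rho 0)); rewrite -involD !addr0. Qed.

Lemma invol1 : rho 1 = 1.
Proof. by rewrite -[RHS](involK rho) -[in RHS](mulr1 (rho 1)) involM involK mulr1. Qed.

Lemma involN u : rho (- u) = - rho u.
Proof. by apply: (addrI (rho u)); rewrite -involD !subrr invol0. Qed.

Lemma invol_sum (I : Type) (r : seq I) (P : pred I) (F : I -> E) :
  rho (\sum_(i <- r | P i) F i) = \sum_(i <- r | P i) rho (F i).
Proof. exact: (big_morph rho (involD rho) invol0). Qed.

Lemma adjmxM m n p (A : 'M_(m, n)) (B : 'M_(n, p)) :
  adjmx (A *m B) = adjmx B *m adjmx A.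
Proof.
apply/matrixP => i j; rewrite !mxE invol_sum.
by apply: eq_bigr => k _; rewrite !mxE involM.
Qed.

Lemma adjmxK m n (A : 'M_(m, n)) : adjmx (adjmx A) = A.
Proof. by apply/matrixP => i j; rewrite !mxE involK. Qed.

Lemma adjmx1 n : adjmx (1%:M : 'M_n) = 1%:M.
Proof.
apply/matrixP => i j; rewrite !mxE eq_sym.
by case: (_ == _); rewrite ?invol1 ?invol0.
Qed.

Lemma adjmx0 m n : adjmx (0 : 'M_(m, n)) = 0.
Proof. by apply/matrixP => i j; rewrite !mxE invol0. Qed.

Lemma adjmxN m n (A : 'M_(m, n)) : adjmx (- A) = - adjmx A.
Proof. by apply/matrixP => i j; rewrite !mxE involN. Qed.

Lemma adjmx_block m1 m2 n1 n2 (A : 'M_(m1, n1)) (B : 'M_(m1, n2))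
    (C : 'M_(m2, n1)) (D : 'M_(m2, n2)) :
  adjmx (block_mx A B C D) = block_mx (adjmx A) (adjmx C) (adjmx B) (adjmx D).
Proof. by rewrite /adjmx tr_block_mx map_block_mx. Qed.

Lemma invertible1 n : invertible_mx (1%:M : 'M_n).
Proof. by exists 1%:M; rewrite mulmx1. Qed.

Lemma invertibleM m n p (P : 'M_(m, n)) (R : 'M_(n, p)) :
  invertible_mx P -> invertible_mx R -> invertible_mx (P *m R).
Proof.
case=> P' [P1 P2] [R' [R1 R2]]; exists (R' *m P'); split.
  by rewrite mulmxA -[P *m R *m R']mulmxA R1 mulmx1.
by rewrite mulmxA -[R' *m P' *m P]mulmxA P2 mulmx1.
Qed.

Lemma congruent_refl n (A : 'M_n) : congruent A A.
Proof. by exists 1%:M; [exact: invertible1 | rewrite mul1mx adjmx1 mulmx1]. Qed.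

Lemma congruent_sym m n (A : 'M_m) (B : 'M_n) : congruent A B -> congruent B A.
Proof.
case=> P [R [PR RP]] <-; exists R; first by exists P.
by rewrite !mulmxA RP mul1mx -mulmxA -adjmxM RP adjmx1 mulmx1.
Qed.

Lemma congruent_trans m n p (A : 'M_m) (B : 'M_n) (C : 'M_p) :
  congruent A B -> congruent B C -> congruent A C.
Proof.
case=> P iP <- [R iR <-]; exists (P *m R); first exact: invertibleM.
by rewrite adjmxM !mulmxA.
Qed.

Lemma congruent_block m1 n1 m2 n2 (A : 'M_m1) (B : 'M_n1) (C : 'M_m2) (D : 'M_n2) :
  congruent A B -> congruent C D -> congruent (block_mx A 0 0 C) (block_mx B 0 0 D).
Proof.
case=> P [P' [P1 P2]] <- [R [R' [R1 R2]]] <-; exists (block_mx P 0 0 R).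
  exists (block_mx P' 0 0 R'); rewrite !mulmx_block !mulmx0 !mul0mx !addr0 !add0r.
  by rewrite P1 P2 R1 R2 -!scalar_mx_block.
rewrite adjmx_block !mulmx_block !adjmx0 !mulmx0 !mul0mx !addr0 !add0r ?mulmx0 ?mul0mx.
by congr block_mx; reflexivity.
Qed.

Lemma congruent_reindex m n (s : 'I_m -> 'I_n) (A : 'M_m) (B : 'M_n) :
  bijective s -> (forall i j, A i j = B (s i) (s j)) -> congruent A B.
Proof.
case=> t st ts e.
pose P : 'M[E]_(m, n) := \matrix_(i, j) (s i == j)%:R.
pose R : 'M[E]_(n, m) := \matrix_(i, j) (i == s j)%:R.
have Pl p (M : 'M_(n, p)) i j : (P *m M) i j = M (s i) j.
  rewrite mxE (bigD1 (s i)) //= mxE eqxx mul1r big1 ?addr0 // => k nk.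
  by rewrite mxE eq_sym (negPf nk) mul0r.
have Rr p (M : 'M_(p, n)) i j : (M *m R) i j = M i (s j).
  rewrite mxE (bigD1 (s j)) //= mxE eqxx mulr1 big1 ?addr0 // => k nk.
  by rewrite mxE (negPf nk) mulr0.
have adjP : adjmx P = R.
  apply/matrixP => i j; rewrite !mxE [s j == i]eq_sym.
  by case: (_ == _); rewrite ?invol1 ?invol0.
exists P; last by apply/matrixP => i j; rewrite adjP Rr Pl e.
exists R; split; apply/matrixP => i j.
  by rewrite Rr !mxE (inj_eq (can_inj st)).
rewrite mxE (bigD1 (t i)) //= !mxE ts eqxx mul1r big1 ?addr0 // => k nk.
rewrite !mxE; case: eqP => [ik|]; last by rewrite mul0r.
by case/eqP: nk; rewrite ik st.
Qed.

Lemma card_inj_bij m n (s : 'I_m -> 'I_n) : m = n -> injective s -> bijective s.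
Proof. by move=> e si; apply: inj_card_bij => //; rewrite !card_ord e. Qed.

Lemma block_congruentC m n (A : 'M_m) (B : 'M_n) :
  congruent (block_mx A 0 0 B) (block_mx B 0 0 A).
Proof.
pose s (i : 'I_(m + n)) : 'I_(n + m) :=
  match split i with inl j => rshift n j | inr j => lshift m j end.
have sl i : s (lshift n i) = rshift n i by rewrite /s (unsplitK (inl i)).
have sr i : s (rshift m i) = lshift m i by rewrite /s (unsplitK (inr i)).
apply: (@congruent_reindex _ _ s).
  apply: card_inj_bij; first exact: addnC.
  move=> i j; case: (split_ordP i) => i' ->; case: (split_ordP j) => j' ->;
    rewrite ?sl ?sr => /eqP;
    by rewrite ?eq_rshift ?eq_lshift ?eq_lrshift ?eq_rlshift // => /eqP ->.
move=> i j; case: (split_ordP i) => i' ->; case: (split_ordP j) => j' ->;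
  by rewrite ?sl ?sr ?block_mxEul ?block_mxEur ?block_mxEdl ?block_mxEdr ?mxE.
Qed.

Lemma block_congruentA m n p (A : 'M_m) (B : 'M_n) (C : 'M_p) :
  congruent (block_mx A 0 0 (block_mx B 0 0 C)) (block_mx (block_mx A 0 0 B) 0 0 C).
Proof.
pose s (i : 'I_(m + (n + p))) : 'I_(m + n + p) := cast_ord (addnA m n p) i.
have s1 i : s (lshift _ i) = lshift p (lshift n i) by apply: val_inj.
have s2 i : s (rshift m (lshift p i)) = lshift p (rshift m i) by apply: val_inj.
have s3 i : s (rshift m (rshift n i)) = rshift (m + n) i.
  by apply: val_inj; rewrite /= addnA.
apply: (@congruent_reindex _ _ s).
  by apply: card_inj_bij; [exact: addnA | exact: cast_ord_inj].
move=> i j; case: (split_ordP i) => i' ->; case: (split_ordP j) => j' ->;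
  try case: (split_ordP i') => i'' ->; try case: (split_ordP j') => j'' ->;
  by rewrite ?s1 ?s2 ?s3 ?(block_mxEul, block_mxEur, block_mxEdl, block_mxEdr) ?mxE.
Qed.

Lemma block_congruent0 n (Z : 'M_0) (A : 'M_n) : congruent (block_mx Z 0 0 A) A.
Proof.
pose s (i : 'I_(0 + n)) : 'I_n := i.
apply: (@congruent_reindex _ _ s); first by exists s.
move=> i j; case: (split_ordP i) => i' ->; first by case: i'.
case: (split_ordP j) => j' ->; first by case: j'.
by rewrite block_mxEdr; congr (A _ _); apply: val_inj.
Qed.

Lemma formP (f : epsform) : form_axiom f.
Proof. by case: f => F /= /asboolP. Qed.

Definition mkform (F : gram) (H : form_axiom F) : epsform := Form (asboolT H).

Lemma sum_form_axiom (f g : epsform) : form_axiom (sumg f g).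
Proof.
case: (formP f) => ef [F [f1 f2]]; case: (formP g) => eg [G [g1 g2]]; split.
  by rewrite /= adjmx_block !adjmx0 ef eg scale_block_mx !scaler0.
exists (block_mx F 0 0 G); rewrite /= !mulmx_block !mulmx0 !mul0mx !addr0 !add0r.
by rewrite f1 f2 g1 g2 -!scalar_mx_block.
Qed.

Definition sumf (f g : epsform) : epsform := mkform (sum_form_axiom f g).

Lemma opp_form_axiom (f : epsform) :
  form_axiom (Tagged (fun n => 'M[E]_n) (- tagged f)).
Proof.
case: (formP f) => ef [F [f1 f2]]; split; first by rewrite /= adjmxN ef scalerN.
by exists (- F); rewrite /= !mulmxN !mulNmx !opprK.
Qed.
Definition oppf (f : epsform) : epsform := mkform (opp_form_axiom f).

Lemma zero_form_axiom : form_axiom (Tagged (fun n => 'M[E]_n) (0 : 'M[E]_0)).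
Proof.
split; first by rewrite /= adjmx0 scaler0.
by exists 0; split; apply/matrixP => -[].
Qed.
Definition zerof : epsform := mkform zero_form_axiom.

Lemma isometric_refl f : isometric f f. Proof. exact: congruent_refl. Qed.
Lemma isometric_sym f g : isometric f g -> isometric g f.
Proof. exact: congruent_sym. Qed.
Lemma isometric_trans g f h : isometric f g -> isometric g h -> isometric f h.
Proof. exact: congruent_trans. Qed.
Lemma isometric_sum f f' g g' :
  isometric f f' -> isometric g g' -> isometric (sumf f g) (sumf f' g').
Proof. exact: congruent_block. Qed.
Lemma isometric_sumC f g : isometric (sumf f g) (sumf g f).
Proof. exact: block_congruentC. Qed.
Lemma isometric_sumA f g h : isometric (sumf f (sumf g h)) (sumf (sumf f g) h).
Proof. exact: block_congruentA. Qed.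
Lemma isometric_sum0 f : isometric (sumf zerof f) f.
Proof. exact: block_congruent0. Qed.

Lemma isometric_sumACA f g h k :
  isometric (sumf (sumf f g) (sumf h k)) (sumf (sumf f h) (sumf g k)).
Proof.
apply: isometric_trans (isometric_sym (isometric_sumA _ _ _)) _.
apply: isometric_trans _ (isometric_sumA _ _ _).
apply: isometric_sum; first exact: isometric_refl.
apply: isometric_trans (isometric_sumA _ _ _) _.
apply: isometric_trans _ (isometric_sym (isometric_sumA _ _ _)).
by apply: isometric_sum; [exact: isometric_sumC | exact: isometric_refl].
Qed.

Lemma metabolic0 : metabolic zerof.
Proof.
exists 0, 0, 0, 0; apply: (@congruent_reindex _ _ id); first by exists id.
by case.
Qed.

Lemma metabolic_sum f g : metabolic f -> metabolic g -> metabolic (sumf f g).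
Proof.
move=> [m [A [B [C cf]]]] [n [A' [B' [C' cg]]]].
exists (m + n)%N, (block_mx A 0 0 A'), (block_mx B 0 0 B'), (block_mx C 0 0 C').
apply: congruent_trans (congruent_block cf cg) _.
pose s (i : 'I_((m + m) + (n + n))) : 'I_((m + n) + (m + n)) :=
  match split i with
  | inl j => match split j with
    | inl k => lshift _ (lshift n k) | inr k => rshift (m + n) (lshift n k) end
  | inr j => match split j with
    | inl k => lshift _ (rshift m k) | inr k => rshift (m + n) (rshift m k) end
  end.
have s1 i : s (lshift _ (lshift _ i)) = lshift _ (lshift n i).
  by rewrite /s (unsplitK (inl _)) (unsplitK (inl i)).
have s2 i : s (lshift _ (rshift _ i)) = rshift (m + n) (lshift n i).
  by rewrite /s (unsplitK (inl _)) (unsplitK (inr i)).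
have s3 i : s (rshift _ (lshift _ i)) = lshift _ (rshift m i).
  by rewrite /s (unsplitK (inr _)) (unsplitK (inl i)).
have s4 i : s (rshift _ (rshift _ i)) = rshift (m + n) (rshift m i).
  by rewrite /s (unsplitK (inr _)) (unsplitK (inr i)).
apply: (@congruent_reindex _ _ s).
  apply: card_inj_bij; first by rewrite addnACA.
  move=> i j; case: (split_ordP i) => i' ->; case: (split_ordP j) => j' ->;
  case: (split_ordP i') => i'' ->; case: (split_ordP j') => j'' ->;
    rewrite ?(s1, s2, s3, s4) => /eqP;
    by rewrite ?(eq_rshift, eq_lshift, eq_lrshift, eq_rlshift) // => /eqP ->.
move=> i j; case: (split_ordP i) => i' ->; case: (split_ordP j) => j' ->;
  case: (split_ordP i') => i'' ->; case: (split_ordP j') => j'' ->;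
  by rewrite ?(s1, s2, s3, s4)
       ?(block_mxEul, block_mxEur, block_mxEdl, block_mxEdr, mxE)
       ?(block_mxEul, block_mxEur, block_mxEdl, block_mxEdr, mxE).
Qed.

Lemma metabolic_sub f : metabolic (sumf (oppf f) f).
Proof.
exists (form_dim f), (tagged f), (tagged f), (tagged f).
apply: congruent_sym; exists (block_mx 1%:M 1%:M 0 1%:M).
  exists (block_mx 1%:M (- 1%:M) 0 1%:M).
  by rewrite !mulmx_block !mulmx1 !mul1mx !mulmx0 !mul0mx
    !addr0 !add0r addNr subrr -!scalar_mx_block.
rewrite adjmx_block !adjmx1 adjmx0 !mulmx_block !mulmx1 !mul1mx !mulmx0 !mul0mx.
by rewrite !addr0 !add0r addNr.
Qed.

Definition witt_equivalent (f g : epsform) :=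
  exists m m' : epsform,
    [/\ metabolic m, metabolic m' & isometric (sumf f m) (sumf g m')].

Definition witt_equiv : rel epsform := fun f g => `[< witt_equivalent f g >].

Lemma witt_equiv_refl : reflexive witt_equiv.
Proof.
move=> f; apply/asboolP; exists zerof, zerof.
by split; [exact: metabolic0 | exact: metabolic0 | exact: isometric_refl].
Qed.
Lemma witt_equiv_sym : symmetric witt_equiv.
Proof.
suff S f g : witt_equiv f g -> witt_equiv g f by move=> f g; apply/idP/idP; exact: S.
case/asboolP=> m [m' [Mm Mm' i]]; apply/asboolP; exists m', m.
by split=> //; exact: isometric_sym.
Qed.
Lemma witt_equiv_trans : transitive witt_equiv.
Proof.
move=> g f h /asboolP[m [m' [Mm Mm' i]]] /asboolP[p [p' [Mp Mp' j]]].
apply/asboolP; exists (sumf m p), (sumf p' m'); split; try exact: metabolic_sum.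
apply: isometric_trans (isometric_sumA _ _ _) _.
apply: isometric_trans (isometric_sum i (isometric_refl p)) _.
apply: isometric_trans (isometric_sym (isometric_sumA _ _ _)) _.
apply: isometric_trans (isometric_sum (isometric_refl g) (isometric_sumC _ _)) _.
apply: isometric_trans (isometric_sumA _ _ _) _.
apply: isometric_trans (isometric_sum j (isometric_refl m')) _.
exact: isometric_sym (isometric_sumA _ _ _).
Qed.
Canonical witt_equiv_rel := EquivRel witt_equiv witt_equiv_refl witt_equiv_sym witt_equiv_trans.

Definition witt := {eq_quot witt_equiv}%qT.
HB.instance Definition _ := Choice.on witt.
HB.instance Definition _ := EqQuotient.on witt.

Definition witt_class (f : epsform) : witt := (\pi_witt f)%qT.

Lemma witt_classP f g : reflect (witt_equivalent f g) (witt_class f == witt_class g).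
Proof. by rewrite /witt_class piE; exact: asboolP. Qed.

Lemma witt_class_eq f g : witt_equivalent f g -> witt_class f = witt_class g.
Proof. by move/witt_classP/eqP. Qed.

Lemma witt_classW f g : witt_class f = witt_class g -> witt_equivalent f g.
Proof. by move/eqP/witt_classP. Qed.

Lemma witt_isometric f g : isometric f g -> witt_class f = witt_class g.
Proof.
move=> i; apply: witt_class_eq; exists zerof, zerof; split; try exact: metabolic0.
exact: isometric_sum i (isometric_refl _).
Qed.

Lemma witt_reprK (w : witt) : witt_class (repr w) = w.
Proof. exact: reprK. Qed.

Definition witt_add (v w : witt) : witt := witt_class (sumf (repr v) (repr w)).
Definition witt_opp (w : witt) : witt := witt_class (oppf (repr w)).
Definition witt_zero : witt := witt_class zerof.

Lemma witt_addE f g : witt_add (witt_class f) (witt_class g) = witt_class (sumf f g).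
Proof.
have /witt_classW[m [m' [Mm Mm' i]]] := witt_reprK (witt_class f).
have /witt_classW[p [p' [Mp Mp' j]]] := witt_reprK (witt_class g).
apply: witt_class_eq; exists (sumf m p), (sumf m' p'); split; try exact: metabolic_sum.
apply: isometric_trans (isometric_sumACA _ _ _ _) _.
apply: isometric_trans (isometric_sum i j) _.
exact: isometric_sumACA.
Qed.

Lemma witt_addC : commutative witt_add.
Proof.
move=> v w; rewrite -(witt_reprK v) -(witt_reprK w) !witt_addE.
exact/witt_isometric/isometric_sumC.
Qed.
Lemma witt_addA : associative witt_add.
Proof.
move=> u v w; rewrite -(witt_reprK u) -(witt_reprK v) -(witt_reprK w) !witt_addE.
exact/witt_isometric/isometric_sumA.
Qed.
Lemma witt_add0 : left_id witt_zero witt_add.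
Proof.
by move=> w; rewrite -(witt_reprK w) witt_addE; exact/witt_isometric/isometric_sum0.
Qed.
Lemma metabolic_class f : metabolic f -> witt_class f = witt_zero.
Proof.
move=> Mf; apply: witt_class_eq; exists zerof, f.
by split=> //; [exact: metabolic0 | exact: isometric_sumC].
Qed.
Lemma witt_addN : left_inverse witt_zero witt_opp witt_add.
Proof.
move=> w; rewrite -[in X in witt_add _ X](witt_reprK w) witt_addE.
exact/metabolic_class/metabolic_sub.
Qed.
HB.instance Definition _ := GRing.isZmodule.Build witt witt_addA witt_addC witt_add0 witt_addN.

End Forms.

(* The value at 0 (conventionally +oo) is irrelevant. *)
Record normalized_valuation (K : fieldType) := NormalizedValuation {
  val_fun :> K -> int;
  valM : forall c d, c != 0 -> d != 0 -> val_fun (c * d) = val_fun c + val_fun d;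
  valD : forall c d, c != 0 -> d != 0 -> c + d != 0 ->
    Num.min (val_fun c) (val_fun d) <= val_fun (c + d);
  val_normalized : exists2 c, c != 0 & val_fun c = 1
}.

Section Valuations.
Variables (K : fieldType) (nu : normalized_valuation K).

Definition val_ge (N : int) (c : K) : bool := (c == 0) || (N <= nu c).

Definition complete_valuation :=
  forall u : nat -> K,
    (forall N : int, exists n0 : nat, forall m n : nat,
       (n0 <= m)%N -> (n0 <= n)%N -> val_ge N (u m - u n)) ->
    exists l : K, forall N : int, exists n0 : nat, forall n : nat,
      (n0 <= n)%N -> val_ge N (u n - l).

Definition val_ring (c : K) : bool := (c == 0) || (0 <= nu c).
Definition val_ideal (c : K) : bool := (c == 0) || (0 < nu c).
Definition val_unit (c : K) : bool := (c != 0) && (nu c == 0).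

Variables (a b : K).

Definition nuD (d : quaternion a b) : rat := (nu (Nrd d))%:~R / 2%:R.
Definition quat_val_ring (d : quaternion a b) : bool := (d == 0) || (0 <= nuD d).
Definition quat_val_ideal (d : quaternion a b) : bool := (d == 0) || (0 < nuD d).

End Valuations.

(* [red] presents [S] as the quotient O / m: it restricts to a surjective ring
   morphism O -> S with kernel m.  Its values outside O are irrelevant. *)
Record residue_map (R S : nzRingType) (O m : pred R) (red : R -> S) : Prop := ResidueMap {
  red1 : red 1 = 1;
  redD : forall c d, O c -> O d -> red (c + d) = red c + red d;
  redM : forall c d, O c -> O d -> red (c * d) = red c * red d;
  red_surj : forall s, exists2 c, O c & red c = s;
  red_ker : forall c, O c -> (red c = 0 <-> m c)
}.

Section Larmour.
Variables (K : fieldType) (nu : normalized_valuation K) (a b : K).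
Local Notation D := (quaternion a b).
Variables (sigma : involution D) (eps : bool).

Definition ramified (h : epsform sigma eps) :=
  exists (v : seq D) (h1 : epsform sigma eps),
    [/\ forall d, d \in v -> nuD nu d = 1 / 2%:R, form_gram h1 = diagg v & isometric h h1].

(* [d0] and [d1] send the class of h0 _|_ h1, with h0 = <u_1, .., u_p> and
   h1 = <v_1, .., v_q> as below, to the classes of the forms
   <red u_1, .., red u_p> and <red (v_1 p^-1), .., red (v_q p^-1)>. *)
Definition larmour_residues (p : D) (E : nzRingType) (red : D -> E)
    (rho0 rho1 : involution E)
    (d0 : witt sigma eps -> witt rho0 eps) (d1 : witt sigma eps -> witt rho1 false) :=
  forall (u v : seq D) (h h0 h1 : epsform sigma eps),
    (forall d, d \in u -> nuD nu d = 0) ->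
    (forall d, d \in v -> nuD nu d = 1 / 2%:R) ->
    form_gram h0 = diagg u -> form_gram h1 = diagg v -> isometric h (sumf h0 h1) ->
    (exists2 g0 : epsform rho0 eps,
       form_gram g0 = diagg (map red u) & d0 (witt_class h) = witt_class g0) /\
    (exists2 g1 : epsform rho1 false,
       form_gram g1 = diagg [seq red (d / p) | d <- v] &
       d1 (witt_class h) = witt_class g1).

End Larmour.

(* Main.v *)
From HB Require Import structures.
Require Import Defs.
From mathcomp Require Import all_boot all_order all_algebra all_field.
From mathcomp Require Import boolp zify ring lra.

Set Implicit Arguments.
Unset Strict Implicit.
Unset Printing Implicit Defensive.

Import Order.TTheory GRing.Theory Num.Theory.
Local Open Scope ring_scope.

(** The skew elements of D for tauy are the multiples of y in K (tauy_skew), so every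
    skew-hermitian form is diagonal with entries c y. Since r (c y) tauy(r) equals r^2 c y for
    r in K, and - pi c y for r = y, each c can be taken to be a unit of K
    (skew_diag_normalization). As c y has valuation 1/2, every form is ramified, its first
    residue is 0, and its second residue is the form over E with diagonal entries cbar. The
    symmetric elements of (E, iota) are those of k (iota_fixed), so each hermitian form over
    (E, iota) is such a residue.

    It remains to show that two diagonal forms <c_i y> with unit c_i are Witt equivalent over D
    if and only if their residues are Witt equivalent over E (skew_class_inj), and for this
    that one is Witt trivial when the other is. Two facts connect D and E.
    - Isometries lift from E to D (lift_isometry). A matrix lifting an isometry is an isometry
      up to an error in the maximal ideal, which Gram-Schmidt corrects (hensel_gram); the
      pivots are right up to squares, because elements congruent to 1 are squares in the
      complete field K (hensel_sqrt).
    - Isotropic vectors reduce from D to E (residue_isotropic): divide by the coordinate of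
      least valuation.

    Witt cancellation (witt_cancel), proved by quasi-reflections, shows that a Witt trivial
    form is a sum of hyperbolic planes (witt_zero_hyp). If the residue is Witt trivial, its
    isometry with a hyperbolic form lifts (residue_class0). If the form over D is Witt trivial
    and not 0, it is isotropic, so its residue is isotropic and Witt equivalent to a form of
    smaller dimension (isotropic_reduction), whose lift is again Witt trivial by the first
    case; induction on the dimension concludes (skew_class0).

    The structure of the residue field rests on abar not being a square, as D has no zero
    divisors (residue_nonsquare). Hence the two halves of the reduced norm have valuations
    of different parity, and integrality can be read off the coordinates
    (quat_val_ringE, quat_val_idealE). *)

(** * Matrices over a division ring *)

Section DivisionRing.
Variables (F : unitRingType) (divF : is_division_ring F).

Lemma div_mulf_neq0 (x y : F) : x != 0 -> y != 0 -> x * y != 0.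
Proof.
move=> /divF ux /divF uy; apply/eqP => xy0.
by have := unitrMl x uy; rewrite xy0 unitr0 ux.
Qed.

Lemma invertible_mx11 (X : 'M[F]_1) : X 0 0 != 0 -> invertible_mx X.
Proof.
move=> /divF uX; rewrite [X]mx11_scalar; exists ((X 0 0)^-1)%:M.
by rewrite -!scalar_mxM mulrV ?mulVr.
Qed.

Lemma invertible_mx11_neq0 (X : 'M[F]_1) : invertible_mx X -> X 0 0 != 0.
Proof.
case=> Y [/matrixP/(_ 0 0) + _]; rewrite !mxE big_ord1 => e.
by apply: contra_eq_neq e => ->; rewrite mul0r eq_sym oner_neq0.
Qed.

Lemma invertible_block_triangular m n (A : 'M[F]_m) (B : 'M_(m, n)) (C : 'M_n) :
  invertible_mx A -> invertible_mx C -> invertible_mx (block_mx A B 0 C).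
Proof.
case=> A' [AA' A'A] [C' [CC' C'C]]; exists (block_mx A' (- (A' *m B *m C')) 0 C').
rewrite !mulmx_block !mulmx0 !mul0mx !addr0 !add0r AA' A'A CC' C'C.
rewrite mulmxN !mulmxA AA' mul1mx addNr mulNmx -!mulmxA C'C mulmx1 subrr.
by rewrite -!scalar_mx_block.
Qed.

Lemma invertible_block_lower m n (A : 'M[F]_m) (B : 'M_(n, m)) (C : 'M_n) :
  invertible_mx A -> invertible_mx C -> invertible_mx (block_mx A 0 B C).
Proof.
case=> A' [AA' A'A] [C' [CC' C'C]]; exists (block_mx A' 0 (- (C' *m B *m A')) C').
rewrite !mulmx_block !mulmx0 !mul0mx !addr0 !add0r AA' A'A CC' C'C.
rewrite mulmxN !mulmxA CC' mul1mx subrr mulNmx -!mulmxA A'A mulmx1 addNr.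
by rewrite -!scalar_mx_block.
Qed.

(** If the first coordinate of v is nonzero, v on top of the last rows of the identity is
    a triangular matrix; a transvection makes that coordinate nonzero. *)
Lemma extend_row n (v : 'rV[F]_(1 + n)) :
  v != 0 -> exists2 U : 'M_(1 + n), invertible_mx U & usubmx U = v.
Proof.
have first (w : 'rV[F]_(1 + n)) : lsubmx w 0 0 != 0 ->
    exists2 U : 'M_(1 + n), invertible_mx U & usubmx U = w.
  move=> w0; exists (block_mx (lsubmx w) (rsubmx w) 0 1%:M).
    by apply: invertible_block_triangular; [exact: invertible_mx11 | exact: invertible1].
  by rewrite /block_mx col_mxKu hsubmxK.
move=> v0; have [lv0|] := eqVneq (lsubmx v 0 0) 0; last exact: first.
have [j vj] : exists j, rsubmx v 0 j != 0.
  apply/existsP; apply: contra_neqT v0; rewrite negb_exists => /forallP rv0.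
  apply/rowP => i; rewrite mxE; case: (split_ordP i) => i' ->.
    by move: lv0; rewrite [i']ord1 mxE.
  by have /negPn/eqP := rv0 i'; rewrite mxE.
pose T : 'M[F]_(1 + n) := block_mx 1%:M 0 (delta_mx j 0) 1%:M.
have [T' [TT' T'T]] : invertible_mx T.
  by apply: invertible_block_lower; exact: invertible1.
have [|U iU uU] := first (v *m T).
  rewrite -[v]hsubmxK mul_row_block mulmx1 row_mxKl mxE lv0 add0r mxE (bigD1 j) //=.
  rewrite big1 ?addr0; first by rewrite [delta_mx _ _ _ _]mxE !eqxx mulr1.
  by move=> i /negPf ij; rewrite [delta_mx _ _ _ _]mxE ij mulr0.
exists (U *m T'); first by apply: invertibleM => //; exists T.
by rewrite -mul_usub_mx uU -mulmxA TT' mulmx1.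
Qed.

(** There is no determinant over a noncommutative ring; instead, the first row of A is
    nonzero, a change of basis makes it (1, 0), and the remaining block of A again has a
    right inverse. *)
Lemma mulmx1_divC n (A B : 'M[F]_n) : A *m B = 1%:M -> B *m A = 1%:M.
Proof.
elim: n => [|n IHn] in A B *; first by move=> _; apply/matrixP => -[].
rewrite -[n.+1]/(1 + n)%N in A B * => AB.
have tri (M N : 'M[F]_(1 + n)) :
    usubmx M = row_mx 1%:M 0 -> M *m N = 1%:M -> N *m M = 1%:M.
  rewrite -{2 3}(vsubmxK M) => ->; rewrite -(hsubmxK (dsubmx M)) -(submxK N).
  rewrite -/(block_mx _ _ _ _); set c := lsubmx _; set M' := rsubmx _.
  rewrite !mulmx_block !mul1mx !mul0mx !addr0 scalar_mx_block.
  case/eq_block_mx => -> ->; rewrite !mulmx0 !mul0mx !add0r !mulmx1 => e1 e2.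
  have e3 := IHn _ _ e2; rewrite e3 addr0; congr block_mx.
  have -> : dlsubmx N = - (drsubmx N *m c).
    rewrite -[LHS]mul1mx -e3 -mulmxA; apply/eqP.
    by rewrite -addr_eq0 -mulmxDr addrC e1 mulmx0.
  by rewrite addNr.
have [|U [U' [UU' U'U]] uU] := @extend_row n (usubmx A).
  apply/eqP => uA0; have := congr1 usubmx AB; rewrite -mul_usub_mx uA0 mul0mx.
  rewrite scalar_mx_block col_mxKu => /(congr1 lsubmx); rewrite row_mxKl.
  by move/matrixP/(_ 0 0); rewrite !mxE /= => /eqP; rewrite eq_sym oner_eq0.
have uAU : usubmx (A *m U') = row_mx 1%:M 0.
  by rewrite -mul_usub_mx -uU mul_usub_mx UU' scalar_mx_block col_mxKu.
have AU : A *m U' *m (U *m B) = 1%:M.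
  by rewrite mulmxA -[A *m U' *m U]mulmxA U'U mulmx1.
have BA : U *m (B *m A) *m U' = 1%:M by have := tri _ _ uAU AU; rewrite !mulmxA.
have -> : B *m A = U' *m (U *m (B *m A) *m U') *m U.
  by rewrite !mulmxA U'U mul1mx -!mulmxA U'U mulmx1.
by rewrite BA mulmx1.
Qed.

End DivisionRing.

(** * Splitting and diagonalizing forms *)

Section EpsilonForms.
Variables (F : unitRingType) (divF : is_division_ring F).
Variables (rho : involution F) (eps : bool).
Local Notation eta := ((-1) ^+ eps : F).
Local Notation "A ^*" := (adjmx rho A) : ring_scope.
Local Notation diagm s := (tagged (diagg s)).

(** Convertible to the form axiom of the tagged matrix. *)
Definition eps_gram n (A : 'M[F]_n) := A^* = eta *: A /\ invertible_mx A.

Lemma etaK m n (A : 'M[F]_(m, n)) : eta *: (eta *: A) = A.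
Proof. by case: eps; rewrite ?expr0 ?expr1 ?scaleN1r ?scale1r ?opprK. Qed.

Lemma mulmxZe m n p (A : 'M[F]_(m, n)) (B : 'M_(n, p)) : A *m (eta *: B) = eta *: (A *m B).
Proof. by case: eps; rewrite ?expr0 ?expr1 ?scaleN1r ?scale1r ?mulmxN. Qed.

Lemma mulZemx m n p (A : 'M[F]_(m, n)) (B : 'M_(n, p)) : (eta *: A) *m B = eta *: (A *m B).
Proof. by case: eps; rewrite ?expr0 ?expr1 ?scaleN1r ?scale1r ?mulNmx. Qed.

Lemma adjmxD m n (A B : 'M[F]_(m, n)) : (A + B)^* = A^* + B^*.
Proof. by apply/matrixP => i j; rewrite !mxE involD. Qed.

Lemma adjmxB m n (A B : 'M[F]_(m, n)) : (A - B)^* = A^* - B^*.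
Proof. by rewrite adjmxD adjmxN. Qed.

Lemma adjmx_row m n p (A : 'M[F]_(m, n)) (B : 'M_(m, p)) :
  (row_mx A B)^* = col_mx A^* B^*.
Proof. by rewrite /adjmx tr_row_mx map_col_mx. Qed.

Lemma invertible_adjmx m n (P : 'M[F]_(m, n)) : invertible_mx P -> invertible_mx P^*.
Proof. by case=> Q [PQ QP]; exists Q^*; rewrite -!adjmxM PQ QP !adjmx1. Qed.

Lemma eps_gramJ m n (A : 'M[F]_n) (P : 'M_(m, n)) :
  eps_gram A -> invertible_mx P -> eps_gram (P *m A *m P^*).
Proof.
case=> sA iA iP; split; last first.
  by apply: invertibleM; [exact: invertibleM | exact: invertible_adjmx].
by rewrite !adjmxM adjmxK sA mulZemx mulmxZe mulmxA.
Qed.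

Lemma eps_gram_congr m n (A : 'M[F]_m) (B : 'M_n) :
  congruent rho A B -> eps_gram A -> eps_gram B.
Proof. by case/congruent_sym => P iP <- gA; exact: eps_gramJ. Qed.

Lemma eps_gram_block m n (A : 'M[F]_m) (C : 'M_n) :
  eps_gram (block_mx A 0 0 C) <-> eps_gram A /\ eps_gram C.
Proof.
split=> [[] | [[sA [A' [AA' A'A]]] [sC [C' [CC' C'C]]]]].
  rewrite adjmx_block scale_block_mx !scaler0 !adjmx0 => /eq_block_mx[sA _ _ sC].
  case=> Q; rewrite -[Q]submxK !mulmx_block !mulmx0 !mul0mx !addr0 !add0r.
  rewrite scalar_mx_block => -[/eq_block_mx[A1 _ _ C1] /eq_block_mx[A2 _ _ C2]].
  by split; split=> //; [exists (ulsubmx Q) | exists (drsubmx Q)].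
split; first by rewrite adjmx_block scale_block_mx !scaler0 !adjmx0 sA sC.
exists (block_mx A' 0 0 C'); rewrite !mulmx_block !mulmx0 !mul0mx !addr0 !add0r.
by rewrite AA' A'A CC' C'C -!scalar_mx_block.
Qed.

Lemma adjmx_inverse n (A A' : 'M[F]_n) :
  A^* = eta *: A -> A *m A' = 1%:M -> A' *m A = 1%:M -> A'^* = eta *: A'.
Proof.
move=> sA AA' A'A; have : A'^* *m (eta *: A) = 1%:M by rewrite -sA -adjmxM AA' adjmx1.
rewrite mulmxZe => e; rewrite -[LHS]mulmx1 -AA' mulmxA -[A'^* *m A]etaK e.
by rewrite mulZemx mul1mx.
Qed.

(** The row operation that clears the lower left block is, by symmetry of M, adjoint to the
    column operation that clears the upper right one. *)
Lemma block_elimination m n (M : 'M[F]_(m + n)) :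
  M^* = eta *: M -> invertible_mx (ulsubmx M) ->
  exists2 c : 'M_(n, m), c *m ulsubmx M = - dlsubmx M &
    block_mx 1%:M 0 c 1%:M *m M *m (block_mx 1%:M 0 c 1%:M)^* =
    block_mx (ulsubmx M) 0 0 (drsubmx M + c *m ursubmx M).
Proof.
move=> sM [A' [AA' A'A]]; have := sM; rewrite -{1 2}[M]submxK adjmx_block scale_block_mx.
case/eq_block_mx => sA sZ _ _.
have sA' := adjmx_inverse sA AA' A'A.
exists (- (dlsubmx M *m A')); first by rewrite mulNmx -mulmxA A'A mulmx1.
rewrite -{2}[M]submxK adjmx_block !mulmx_block.
rewrite !mul1mx !mul0mx !addr0 !adjmx1 !adjmx0 !mulmx1 !mulmx0 !addr0.
have e1 : - (dlsubmx M *m A') *m ulsubmx M + dlsubmx M = 0.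
  by rewrite mulNmx -mulmxA A'A mulmx1 addNr.
rewrite e1 mul0mx !add0r; congr block_mx; last by rewrite addrC.
rewrite adjmxN mulmxN adjmxM sZ sA' mulmxZe mulZemx etaK mulmxA AA' mul1mx.
by rewrite addNr.
Qed.

Lemma mx11P (X Y : 'M[F]_1) : X 0 0 = Y 0 0 -> X = Y.
Proof. by move=> e; apply/matrixP => i j; rewrite !ord1. Qed.

(** Take v as first basis vector and eliminate with the pivot h(v, v). *)
Lemma split_vector n (A : 'M[F]_(1 + n)) (v : 'rV_(1 + n)) :
  eps_gram A -> (v *m A *m v^*) 0 0 != 0 ->
  exists (P : 'M_(1 + n)) (C : 'M_n),
    [/\ invertible_mx P, usubmx P = v, eps_gram C
      & P *m A *m P^* = block_mx (v *m A *m v^*) 0 0 C].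
Proof.
move=> gA v0; have [|U iU uU] := extend_row divF (v := v).
  by apply: contra_neq v0 => ->; rewrite !mul0mx mxE.
have gM := eps_gramJ gA iU; set M := U *m A *m U^* in gM *.
have ulM : ulsubmx M = v *m A *m v^*.
  have uUs : lsubmx U^* = v^* by rewrite -uU; apply/matrixP => i j; rewrite !mxE.
  by rewrite /ulsubmx -2!mul_usub_mx -mulmx_lsub uUs uU.
have [|c _ ec] := block_elimination gM.1.
  by rewrite ulM; exact: invertible_mx11.
set L := block_mx _ _ _ _ in ec.
have iL : invertible_mx L by apply: invertible_block_lower; exact: invertible1.
have := eps_gramJ gM iL; rewrite ec eps_gram_block => -[_ gC].
exists (L *m U), (drsubmx M + c *m ursubmx M); split=> //.
- exact: invertibleM.
- by rewrite -mul_usub_mx /L col_mxKu -[U]vsubmxK mul_row_col mul1mx mul0mx addr0 uU.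
- by rewrite adjmxM -ulM -ec /M !mulmxA.
Qed.

(** The possible entries of a nondegenerate diagonal form. *)
Definition eps_sym (x : F) := (rho x == eta * x) && (x != 0).

Lemma two_mul_neq0 (x : F) : (2 : F) != 0 -> x != 0 -> x + x != 0.
Proof. by move=> two0 x0; rewrite -mulr2n -mulr_natl div_mulf_neq0. Qed.

(** If h vanished on the diagonal, polarization would give z + eta z^* = 0 for every value z
    of h; a nonzero form takes all values, and z = t gives 2 t = 0. The existence of t is what
    excludes alternating forms. *)
Lemma anisotropic_vector n (A : 'M[F]_n.+1) (t : F) :
  (2 : F) != 0 -> eps_sym t -> eps_gram A -> exists v : 'rV_n.+1, (v *m A *m v^*) 0 0 != 0.
Proof.
move=> two0 /andP[/eqP st t0] [sA [B [AB _]]]; apply/not_existsP => av0.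
have alt (v : 'rV_n.+1) : v *m A *m v^* = 0.
  by apply: mx11P; rewrite [RHS]mxE; apply/eqP/negPn/negP; exact: av0.
have [i [j Aij]] : exists i j, A i j != 0.
  have /existsP[i] : [exists i, [exists j, A i j != 0]].
    apply: contra_eqT AB; rewrite negb_exists => /forallP A0.
    suff -> : A = 0.
      rewrite mul0mx; apply/eqP => /matrixP/(_ 0 0); rewrite !mxE /= => /eqP.
      by rewrite eq_sym oner_eq0.
    apply/matrixP => i j; have := A0 i; rewrite negb_exists.
    by move=> /forallP/(_ j)/negPn/eqP ->; rewrite mxE.
  by case/existsP=> j; exists i, j.
pose v : 'rV[F]_n.+1 := (t * (A i j)^-1) *: delta_mx 0 i.
pose w : 'rV[F]_n.+1 := delta_mx 0 j.
have vw : v *m A *m w^* = t%:M.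
  apply: mx11P; rewrite /v -!scalemxAl -rowE mxE mxE (bigD1 j) //= big1 => [|l lj].
    by rewrite !mxE !eqxx invol1 mulr1 addr0 mulrVK ?divF.
  by rewrite !mxE (negPf lj) invol0 mulr0.
have wv : w *m A *m v^* = t%:M.
  have e : (v *m A *m w^*)^* = eta *: (w *m A *m v^*).
    by rewrite !adjmxM adjmxK sA mulZemx mulmxZe mulmxA.
  rewrite -[LHS]etaK -e vw.
  by apply: mx11P; rewrite !mxE st; case: eps; rewrite ?expr0 ?expr1 ?mulN1r ?mul1r ?opprK.
have := alt (v + w); rewrite adjmxD !mulmxDl !mulmxDr !alt vw wv add0r addr0.
by move/matrixP/(_ 0 0); rewrite !mxE /= => /eqP; rewrite (negPf (two_mul_neq0 _ _)).
Qed.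

Lemma diagg_cons x s :
  diagm (x :: s) = block_mx (x%:M : 'M_1) 0 0 (diagm s) :> 'M[F]_(1 + size s).
Proof.
apply/matrixP => i j; rewrite mxE mxE.
case: (split_ordP i) => i' ->; case: (split_ordP j) => j' ->;
  rewrite ?block_mxEul ?block_mxEur ?block_mxEdl ?block_mxEdr !mxE.
- by rewrite !ord1.
- by rewrite [i']ord1.
- by rewrite [j']ord1.
- by [].
Qed.

Lemma diagg_cons_congruent x s :
  congruent rho (diagm (x :: s)) (block_mx (x%:M : 'M_1) 0 0 (diagm s)).
Proof. by rewrite diagg_cons; exact: congruent_refl. Qed.

Lemma diagg_cat s t :
  congruent rho (diagm (s ++ t)) (block_mx (diagm s) 0 0 (diagm t)).
Proof.
elim: s => [|x s IHs]; first exact/congruent_sym/block_congruent0.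
rewrite cat_cons; apply: congruent_trans (diagg_cons_congruent _ _) _.
apply: (congruent_trans (B := block_mx (x%:M : 'M_1) 0 0 (block_mx (diagm s) 0 0 (diagm t)))).
  by apply: congruent_block IHs; exact: congruent_refl.
apply: congruent_trans (block_congruentA _ _ _ _) _.
apply: congruent_block (congruent_refl _ _).
exact/congruent_sym/diagg_cons_congruent.
Qed.

Lemma eps_gram11 (x : F) : eps_gram (x%:M : 'M_1) <-> eps_sym x.
Proof.
rewrite /eps_sym; split.
  case=> /matrixP/(_ 0 0) + /invertible_mx11_neq0; rewrite !mxE /= => e x0.
  rewrite !mulr1n in e x0; rewrite x0 andbT e.
  by case: eps; rewrite ?expr0 ?expr1 ?mulN1r ?mul1r ?scaleN1r ?scale1r.
case/andP=> /eqP e x0; split; last by apply: invertible_mx11 => //; rewrite mxE.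
by apply: mx11P; rewrite !mxE /= !mulr1n e.
Qed.

Lemma eps_gram_diag s : eps_gram (diagm s) <-> all eps_sym s.
Proof.
elim: s => [|x s IHs].
  by split=> // _; split; [|exists 0; split]; apply/matrixP => -[].
rewrite -[eps_gram _]/(@eps_gram (1 + size s) (diagm (x :: s))) diagg_cons.
rewrite eps_gram_block eps_gram11 IHs /=; split; first by case=> -> ->.
by case/andP.
Qed.

Lemma diagonalization n (A : 'M[F]_n) (t : F) :
  (2 : F) != 0 -> eps_sym t -> eps_gram A ->
  exists s, [/\ size s = n, all eps_sym s & congruent rho A (diagm s)].
Proof.
move=> two0 et; elim: n A => [|n IHn] A gA.
  exists [::]; split=> //; apply: (@congruent_reindex _ _ _ _ id); first by exists id.
  by case.
have [v v0] := anisotropic_vector two0 et gA.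
have [P [C [iP _ gC e]]] := split_vector gA v0.
have [s [sz gs cs]] := IHn C gC.
have := eps_gramJ gA iP; rewrite e [_ *m v^*]mx11_scalar eps_gram_block eps_gram11.
case=> ev _; exists ((v *m A *m v^*) 0 0 :: s).
split=> /=; [by rewrite sz | by rewrite ev | ].
apply: (@congruent_trans _ _ _ _ _ _ (P *m A *m P^*)).
  by apply: congruent_sym; exists P.
apply: congruent_trans _ (congruent_sym (diagg_cons_congruent _ _)).
by rewrite e -mx11_scalar; apply: congruent_block cs; exact: congruent_refl.
Qed.

End EpsilonForms.

(** * Witt cancellation *)

Section Cancellation.
Variables (F : unitRingType) (divF : is_division_ring F).
Variables (rho : involution F) (eps : bool).
Hypothesis two0 : (2 : F) != 0.
Local Notation eta := ((-1) ^+ eps : F).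
Local Notation "A ^*" := (adjmx rho A) : ring_scope.
Local Notation diagm s := (tagged (diagg s)).
Local Notation eps_gram := (eps_gram rho eps).
Local Notation eps_sym := (eps_sym rho eps).

Local Notation mulZemx := (@mulZemx F eps).
Local Notation mulmxZe := (@mulmxZe F eps).

(** With d = v - w and a = h(v, d), the map x |-> x - h(x, d) a^-1 d sends v to w, and is an
    isometry because h(d, d) = a + eta a^*. *)
Lemma quasi_reflection n (A : 'M[F]_n) (v w : 'rV_n) :
  eps_gram A -> v *m A *m v^* = w *m A *m w^* -> (v *m A *m (v - w)^*) 0 0 != 0 ->
  exists P : 'M_n, [/\ invertible_mx P, P *m A *m P^* = A & v *m P = w].
Proof.
move=> [sA [A' [AA' A'A]]] vw; set d := v - w; set a := v *m A *m d^* => a0.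
have [b [ab ba]] := invertible_mx11 divF a0.
have ea : a^* = eta *: (d *m A *m v^*).
  by rewrite /a !adjmxM adjmxK sA mulZemx mulmxZe mulmxA.
have aw : a = - (d *m A *m w^*).
  by rewrite /a /d adjmxB mulmxBr vw !mulmxBl opprB.
have dd : d *m A *m d^* = a + eta *: a^*.
  by rewrite ea etaK [in RHS]aw [in d^*]/d adjmxB mulmxBr addrC.
have ba' : a^* *m b^* = 1%:M by rewrite -adjmxM ba adjmx1.
pose P := 1%:M - A *m d^* *m b *m d.
have key : b *m (d *m A *m d^*) *m b^* = b^* + eta *: b.
  by rewrite dd mulmxDr ba mulmxDl mul1mx mulmxZe mulZemx -mulmxA ba' mulmx1.
have PAP : P *m A *m P^* = A.
  have AP : A *m P^* = A - eta *: (A *m d^* *m b^* *m (d *m A)).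
    by rewrite adjmxB adjmx1 !adjmxM adjmxK sA mulmxBr mulmx1 !mulmxZe !mulmxA.
  have e : A *m d^* *m b *m d *m (A *m d^* *m b^* *m (d *m A)) =
      A *m d^* *m b^* *m (d *m A) + eta *: (A *m d^* *m b *m d *m A).
    transitivity (A *m d^* *m (b *m (d *m A *m d^*) *m b^*) *m (d *m A)).
      by rewrite !mulmxA.
    by rewrite key mulmxDr mulmxDl mulmxZe mulZemx !mulmxA.
  rewrite -mulmxA AP mulmxBl mul1mx mulmxBr mulmxZe e scalerDr etaK.
  by rewrite opprB addrK addrNK.
exists P; split=> //; last first.
  by rewrite mulmxBr mulmx1 !mulmxA ab mul1mx /d opprB addrC addrNK.
have PR : P *m (A *m P^* *m A') = 1%:M by rewrite !mulmxA PAP.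
by exists (A *m P^* *m A'); split=> //; exact: mulmx1_divC.
Qed.

(** One of the quasi-reflections for w and for - w exists: if h(v, v - w) = 0, then
    h(v, v + w) = 2 h(v, v) is nonzero. *)
Lemma transitive_isometry n (A : 'M[F]_n) (v w : 'rV_n) :
  eps_gram A -> v *m A *m v^* = w *m A *m w^* -> (v *m A *m v^*) 0 0 != 0 ->
  exists P : 'M_n, [/\ invertible_mx P, P *m A *m P^* = A & v *m P = w].
Proof.
move=> gA vw v0; have [a0|] := eqVneq ((v *m A *m (v - w)^*) 0 0) 0; last first.
  exact: quasi_reflection.
have vw' : v *m A *m v^* = - w *m A *m (- w)^*.
  by rewrite adjmxN mulmxN !mulNmx opprK.
have [|P [[Q [PQ QP]] PAP vP]] := quasi_reflection gA vw'.
  rewrite opprK.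
  have -> : v + w = v + v - (v - w) by rewrite opprB [RHS]addrC addrA addrNK addrC.
  rewrite adjmxB mulmxBr mxE [X in _ + X]mxE a0 oppr0 addr0.
  by rewrite adjmxD mulmxDr mxE two_mul_neq0.
exists (- P); split; last by rewrite mulmxN vP opprK.
  by exists (- Q); rewrite !mulmxN !mulNmx !opprK.
by rewrite adjmxN mulmxN !mulNmx opprK.
Qed.

(** An isometry between the two sums can be corrected, by transitivity on vectors of value x,
    to fix the first basis vector; it is then block diagonal. *)
Lemma witt_cancel1 m n (x : F) (G : 'M[F]_m) (H : 'M_n) :
  eps_gram G -> eps_sym x ->
  congruent rho (block_mx (x%:M : 'M_1) 0 0 H) (block_mx (x%:M : 'M_1) 0 0 G) ->
  congruent rho H G.
Proof.
move=> gG ex [P iP e].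
have gM : eps_gram (block_mx (x%:M : 'M_1) 0 0 G) by apply/eps_gram_block; rewrite eps_gram11.
set M := block_mx _ _ _ _ in e gM.
have x0 : x != 0 by case/andP: ex.
pose f : 'rV[F]_(1 + m) := row_mx 1%:M 0.
have fM : f *m M *m f^* = x%:M.
  rewrite /f /M mul_row_block !mul0mx mul1mx mulmx0 !addr0.
  by rewrite adjmx_row mul_row_col mul0mx addr0 adjmx1 mulmx1.
have pM : usubmx P *m M *m (usubmx P)^* = x%:M.
  have uPs : lsubmx P^* = (usubmx P)^* by apply/matrixP => i j; rewrite !mxE.
  by rewrite -uPs mulmx_lsub mul_usub_mx mul_usub_mx e -/(ulsubmx _) block_mxKul.
have [||Q [iQ QMQ pQ]] := transitive_isometry gM (v := usubmx P) (w := f).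
- by rewrite fM.
- by rewrite pM mxE.
have iR := invertibleM iP iQ.
have eR : P *m Q *m M *m (P *m Q)^* = block_mx (x%:M : 'M_1) 0 0 H.
  by rewrite adjmxM -e -[in RHS]QMQ !mulmxA.
have uR : usubmx (P *m Q) = f by rewrite -mul_usub_mx.
move: (P *m Q) iR eR uR => R iR eR uR.
have eRb : R = block_mx 1%:M 0 (dlsubmx R) (drsubmx R).
  by rewrite -[LHS]vsubmxK uR -[dsubmx R]hsubmxK.
move: (dlsubmx R) (drsubmx R) eRb => c S eRb; rewrite {}eRb in iR eR uR.
move: eR; rewrite adjmx_block !mulmx_block !adjmx0 !adjmx1 !mul1mx !mul0mx.
rewrite !mulmx0 !mulmx1 !addr0 !add0r => /eq_block_mx[_ _ cx eH].
have c0 : c = 0.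
  have [|Y [xY _]] := invertible_mx11 divF (X := x%:M); first by rewrite mxE.
  by rewrite -[c]mulmx1 -xY mulmxA cx mul0mx.
rewrite c0 !mul0mx add0r in eH iR.
exists S => //; case: iR => T; rewrite -[T]submxK !mulmx_block !mul0mx !mulmx0 !addr0 !add0r.
rewrite 2!scalar_mx_block => -[/eq_block_mx[_ _ _ S1] /eq_block_mx[_ _ _ S2]].
by exists (drsubmx T).
Qed.

Lemma witt_cancel m n (s : seq F) (G : 'M[F]_m) (H : 'M_n) :
  eps_gram G -> all eps_sym s ->
  congruent rho (block_mx (diagm s) 0 0 H) (block_mx (diagm s) 0 0 G) ->
  congruent rho H G.
Proof.
move=> gG; elim: s => [_ c|x s IHs /= /andP[ex es] c].
  apply: congruent_trans (congruent_sym (block_congruent0 _ _ _)) _.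
  exact: congruent_trans c (block_congruent0 _ _ _).
apply: IHs => //; apply: (witt_cancel1 (x := x)) => //.
  by apply/eps_gram_block; split=> //; exact/eps_gram_diag.
have reassoc k (B : 'M_k) : congruent rho (block_mx (diagm (x :: s)) 0 0 B)
    (block_mx (x%:M : 'M_1) 0 0 (block_mx (diagm s) 0 0 B)).
  apply: congruent_trans (congruent_sym (block_congruentA _ _ _ _)).
  exact: congruent_block (diagg_cons_congruent _ _ _) (congruent_refl _ _).
exact: congruent_trans (congruent_sym (reassoc _ _)) (congruent_trans c (reassoc _ _)).
Qed.

End Cancellation.

(** * Hyperbolic forms and Witt classes *)

Section Reindexing.
Variables (F : nzRingType) (rho : involution F).
Local Notation diagm s := (tagged (diagg s)).

Lemma congruent_perm (s t : seq F) : perm_eq s t -> congruent rho (diagm s) (diagm t).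
Proof.
move=> st; have sz := perm_size st; move: (st); rewrite perm_sym.
case/(perm_iotaP 0) => Is; rewrite perm_sym => pI et.
have szI : size Is = size s by rewrite -(perm_size pI) size_iota.
have ltI i : (i < size t)%N -> (nth 0%N Is i < size s)%N.
  move=> it; have : nth 0%N Is i \in iota 0 (size s).
    by rewrite (perm_mem pI) mem_nth // szI sz.
  by rewrite mem_iota add0n.
pose f (i : 'I_(size t)) : 'I_(size s) := Ordinal (ltI i (ltn_ord i)).
apply: congruent_sym; apply: (@congruent_reindex _ _ _ _ f).
  apply: card_inj_bij => // i j /(congr1 val) /= /eqP.
  rewrite nth_uniq ?szI ?sz ?ltn_ord // => [/eqP ij|]; first exact: val_inj.
  by rewrite -(perm_uniq pI) iota_uniq.
move=> i j; rewrite !mxE -[f i == f j]/(nth 0%N Is i == nth 0%N Is j).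
rewrite nth_uniq ?szI ?sz ?ltn_ord //; last by rewrite -(perm_uniq pI) iota_uniq.
by rewrite {1}et (nth_map 0%N) // szI sz.
Qed.

Lemma congruent_diag_mx n (f : 'I_n -> F) (s : seq F) :
  size s = n -> (forall i : 'I_n, s`_i = f i) ->
  congruent rho (diagm s) (diag_mx (\row_(i < n) f i)).
Proof.
move=> sz e; apply: (@congruent_reindex _ _ _ _ (cast_ord sz)).
  by exists (cast_ord (esym sz)); [exact: cast_ordK | exact: cast_ordKV].
by move=> i j; rewrite !mxE -e /= (inj_eq (@cast_ord_inj _ _ _)).
Qed.

Lemma congruent_scalar_mx n (u : F) : congruent rho (u%:M : 'M_n) (diagm (nseq n u)).
Proof.
apply: congruent_sym; apply: congruent_trans (congruent_diag_mx (f := fun=> u) _ _) _.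
- by rewrite size_nseq.
- by move=> i; rewrite nth_nseq ltn_ord.
- suff -> : diag_mx (\row__ u) = u%:M :> 'M[F]_n by exact: congruent_refl.
  by apply/matrixP => i j; rewrite !mxE.
Qed.

Lemma congruent_dim0 m (A : 'M[F]_m) (B : 'M_0) : congruent rho A B -> m = 0%N.
Proof.
case=> P [Q [PQ _]] _; case: m A P Q PQ => // m A P Q /matrixP/(_ 0 0).
by rewrite !mxE big_ord0 => /eqP; rewrite eq_sym oner_eq0.
Qed.

End Reindexing.

Section Hyperbolic.
Variables (F : unitRingType) (divF : is_division_ring F).
Variables (rho : involution F) (eps : bool).
Hypothesis two0 : (2 : F) != 0.
Local Notation eta := ((-1) ^+ eps : F).
Local Notation "A ^*" := (adjmx rho A) : ring_scope.
Local Notation diagm s := (tagged (diagg s)).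
Local Notation eps_gram := (eps_gram rho eps).
Local Notation eps_sym := (eps_sym rho eps).
Local Notation mulZemx := (@mulZemx F eps).
Local Notation mulmxZe := (@mulmxZe F eps).

(** Being central and symmetric, this half of 1 passes through products and adjoints. *)
Lemma central_half : exists h : F, [/\ h + h = 1, rho h = h & forall x, h * x = x * h].
Proof.
have u2 : (2 : F) \is a GRing.unit by exact: divF.
have hh : 2^-1 + 2^-1 = 1 :> F by rewrite -[LHS]mulr2n -[LHS]mulr_natl mulrV.
exists 2^-1; split=> // [|x].
  apply: (mulrI u2); rewrite !mulr_natl !mulr2n hh.
  by rewrite -involD hh invol1.
exact/commr_sym/commrV/commr_nat.
Qed.

(** Make the upper right block the identity, then change the complement of the Lagrangian by
    X = - C / 2, which is possible because X + eta X^* = - C. *)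
Lemma metabolic_hyperbolic n (A B C : 'M[F]_n) :
  eps_gram (block_mx (0 : 'M_n) A B C) ->
  congruent rho (block_mx 0 A B C) (block_mx (0 : 'M_n) 1%:M (eta *: 1%:M) (0 : 'M_n)).
Proof.
move=> [+ [Q [MQ _]]]; rewrite adjmx_block scale_block_mx => /eq_block_mx[_ _ sA sC].
move: MQ; rewrite -[Q]submxK mulmx_block !mul0mx !add0r scalar_mx_block.
case/eq_block_mx; move: (dlsubmx Q) => A' AA' _ _ _; have A'A := mulmx1_divC divF AA'.
have [h [hh rh ch]] := central_half.
pose X := - (h *: C).
have eX : eta *: X^* = X.
  rewrite /X adjmxN.
  have -> : (h *: C)^* = h *: C^* by apply/matrixP => i j; rewrite !mxE involM rh ch.
  rewrite sC; case: (eps); last by rewrite expr0 !scale1r.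
  by rewrite expr1 !scaleN1r scalerN opprK.
have XX : X + X + C = 0.
  by rewrite /X -opprD -scalerDl hh scale1r addNr.
apply: congruent_sym; exists (block_mx A' 0 (X *m A') 1%:M).
  apply: invertible_block_lower; last exact: invertible1.
  by exists A.
have BA : B *m A'^* = eta *: 1%:M.
  by rewrite -[B](@etaK _ eps) -sA mulZemx -adjmxM A'A adjmx1.
rewrite adjmx_block !mulmx_block !mulmx0 !mul0mx !addr0 !add0r adjmx0 adjmx1 !mulmx1 !mul1mx.
rewrite adjmxM !mulmxA !mul0mx !mulmx0 !add0r !addr0 BA -mulmxA A'A mulmx1.
congr block_mx.
by rewrite mulZemx mul1mx eX addrA.
Qed.

(** The orthogonal sum of n hyperbolic planes, as a diagonal form. *)
Definition hyp (u : F) n := nseq n (- u) ++ nseq n u.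

Lemma eps_symN u : eps_sym u -> eps_sym (- u).
Proof. by case/andP=> /eqP e u0; apply/andP; rewrite involN e mulrN eqxx oppr_eq0. Qed.

Lemma all_hyp u n : eps_sym u -> all eps_sym (hyp u n).
Proof. by move=> eu; rewrite all_cat !all_nseq eu eps_symN // !orbT. Qed.

Lemma hyp_metabolic u n :
  congruent rho (diagm (hyp u n)) (block_mx 0 (u%:M : 'M_n) u%:M u%:M).
Proof.
apply: congruent_trans (diagg_cat _ _ _) _.
apply: congruent_trans (congruent_block (congruent_sym (congruent_scalar_mx _ _ _))
  (congruent_sym (congruent_scalar_mx _ _ _))) _.
apply: congruent_sym; exists (block_mx 1%:M 1%:M 0 1%:M).
  by apply: invertible_block_triangular; exact: invertible1.
rewrite adjmx_block !adjmx1 adjmx0 !mulmx_block !mulmx1 !mul1mx !mulmx0 !mul0mx.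
by rewrite !addr0 !add0r raddfN addNr.
Qed.

Lemma metabolic_hyp (f : epsform rho eps) u :
  eps_sym u -> metabolic f -> exists n, congruent rho (tagged f) (diagm (hyp u n)).
Proof.
move=> eu [n [A [B [C c]]]]; exists n.
have gh : eps_gram (diagm (hyp u n)) by apply/eps_gram_diag => //; exact: all_hyp.
apply: (congruent_trans c); apply: congruent_trans (metabolic_hyperbolic _) _.
  exact: eps_gram_congr c (formP f).
have c' := hyp_metabolic u n.
apply: congruent_trans (congruent_sym (metabolic_hyperbolic _)) (congruent_sym c').
exact: eps_gram_congr c' gh.
Qed.

Lemma hyp_split u p r q : (p + r = q)%N ->
  congruent rho (diagm (hyp u q)) (block_mx (diagm (hyp u p)) 0 0 (diagm (hyp u r))).
Proof.
move=> <-; apply: congruent_trans _ (diagg_cat _ _ _); apply: congruent_perm.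
by rewrite /hyp !nseqD perm_catACA.
Qed.

(** By definition f _|_ H_p ~ H_q for some sums H_p and H_q of p and q hyperbolic planes;
    cancel the common planes. When q < p, what remains is f _|_ H_(p - q) ~ 0, so f has
    dimension 0. *)
Lemma witt_zero_hyp (f : epsform rho eps) u :
  eps_sym u -> witt_class f = 0 -> exists r, congruent rho (tagged f) (diagm (hyp u r)).
Proof.
move=> eu /witt_classW[m [m' [Mm Mm' i]]].
have [p cp] := metabolic_hyp eu Mm; have [q cq] := metabolic_hyp eu Mm'.
have gh r : eps_gram (diagm (hyp u r)) by apply/eps_gram_diag => //; exact: all_hyp.
have cf : congruent rho (block_mx (diagm (hyp u p)) 0 0 (tagged f)) (diagm (hyp u q)).
  apply: congruent_trans (block_congruentC _ _ _) _.
  apply: congruent_trans (congruent_block (congruent_refl _ _) (congruent_sym cp)) _.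
  apply: congruent_trans i _; apply: congruent_trans (block_congruent0 _ _ _) _.
  exact: cq.
have [pq|qp] := leqP p q.
  exists (q - p)%N; apply: (witt_cancel divF two0 (gh _) (all_hyp p eu)).
  by apply: (congruent_trans cf); exact/hyp_split/subnKC.
exists 0%N.
have c0 : congruent rho (block_mx (diagm (hyp u (p - q))) 0 0 (tagged f)) (diagm (hyp u 0)).
  apply: (witt_cancel divF two0 (gh _) (all_hyp q eu)).
  apply: congruent_trans (block_congruentA _ _ _ _) _.
  apply: (congruent_trans (B := block_mx (diagm (hyp u p)) 0 0 (tagged f))).
    apply: congruent_block (congruent_refl _ _).
    exact/congruent_sym/hyp_split/subnKC/ltnW.
  by apply: (congruent_trans cf); exact/hyp_split/addn0.
have /eqP := congruent_dim0 c0; rewrite addn_eq0 => /andP[_ /eqP f0].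
move: (tagged f); rewrite f0 => A.
by apply: (@congruent_reindex _ _ _ _ id); [exists id | case].
Qed.

Lemma hyp_isotropic (f : epsform rho eps) u r :
  congruent rho (tagged f) (diagm (hyp u r)) -> form_dim f != 0%N ->
  exists2 v : 'rV_(form_dim f), v != 0 & v *m tagged f *m v^* = 0.
Proof.
move=> cf; have {cf} := congruent_trans cf (hyp_metabolic u r).
case: r => [|r] c f0.
  by have := congruent_dim0 c; rewrite -/(form_dim f) => /eqP; rewrite (negPf f0).
have [Q [P [QP PQ]] e] := congruent_sym c.
pose g : 'rV[F]_(r.+1 + r.+1) := row_mx (delta_mx 0 0) 0.
exists (g *m Q).
  apply: contraTneq isT => gQ0; have : g = 0 by rewrite -[g]mulmx1 -QP mulmxA gQ0 mul0mx.
  move/matrixP/(_ 0 (lshift _ 0)); rewrite row_mxEl !mxE !eqxx => /eqP.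
  by rewrite oner_eq0.
rewrite adjmxM !mulmxA -(mulmxA g) -(mulmxA g) e /g mul_row_block !mul0mx mulmx0 !addr0.
by rewrite adjmx_row adjmx0 mul_row_col mul0mx mulmx0 addr0.
Qed.

End Hyperbolic.

Section GramClasses.
Variables (F : unitRingType) (divF : is_division_ring F).
Variables (rho : involution F) (eps : bool).
Local Notation diagm s := (tagged (diagg s)).
Local Notation eps_sym := (eps_sym rho eps).

(** Defined on all matrices so that congruences of Gram matrices give equations between
    classes without carrying proofs of nondegeneracy. *)
Definition gram_class (G : gram F) : witt rho eps :=
  witt_class (insubd (zerof rho eps) G).

Lemma insub_gram (G : gram F) :
  form_axiom rho eps G -> form_gram (insubd (zerof rho eps) G) = G.
Proof. by move=> gG; apply: (insubdK (zerof rho eps)); exact/asboolP. Qed.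

Lemma gram_classE (f : epsform rho eps) : gram_class (form_gram f) = witt_class f.
Proof.
by congr witt_class; apply: val_inj; apply: insub_gram; exact: formP.
Qed.

Lemma gram_class_congruent (G H : gram F) :
  form_axiom rho eps G -> congruent rho (tagged G) (tagged H) -> gram_class G = gram_class H.
Proof.
move=> gG c; have gH : form_axiom rho eps H := eps_gram_congr c gG.
apply: witt_isometric; rewrite /isometric !insub_gram //.
Qed.

Lemma gram_class_sum (G H : gram F) :
  form_axiom rho eps G -> form_axiom rho eps H ->
  gram_class (sumg G H) = gram_class G + gram_class H.
Proof.
move=> gG gH; have := witt_addE (insubd (zerof rho eps) G) (insubd (zerof rho eps) H).
rewrite -[witt_add _ _]/(gram_class G + gram_class H) => ->; rewrite -gram_classE /=.
by congr gram_class; rewrite !insub_gram.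
Qed.

Definition diag_class s := gram_class (diagg s).

Lemma diag_axiom s : all eps_sym s -> form_axiom rho eps (diagg s).
Proof. by move=> es; apply/eps_gram_diag. Qed.

Lemma diag_class_cat s t : all eps_sym s -> all eps_sym t ->
  diag_class (s ++ t) = diag_class s + diag_class t.
Proof.
move=> es et; rewrite -gram_class_sum; try exact: diag_axiom.
apply: gram_class_congruent; last exact: diagg_cat.
by apply: diag_axiom; rewrite all_cat es.
Qed.

Lemma metabolic_gram_class (G : gram F) n (A B C : 'M_n) :
  form_axiom rho eps G -> congruent rho (tagged G) (block_mx 0 A B C) -> gram_class G = 0.
Proof.
move=> gG c; apply: metabolic_class; exists n, A, B, C.
by rewrite insub_gram.
Qed.

Lemma diag_class_hyp u r : eps_sym u -> diag_class (hyp u r) = 0.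
Proof.
move=> eu; apply: metabolic_gram_class (hyp_metabolic _ u r).
by apply: diag_axiom; exact: all_hyp.
Qed.

Lemma diag_classN s : all eps_sym s -> diag_class [seq - x | x <- s] = - diag_class s.
Proof.
move=> es; pose f : epsform rho eps := insubd (zerof rho eps) (diagg s).
have ef : form_gram f = diagg s by apply: insub_gram; exact: diag_axiom.
have -> : - diag_class s = witt_class (Defs.oppf f).
  apply/esym/eqP; rewrite -addr_eq0; apply/eqP.
  have := witt_addE (Defs.oppf f) f.
  rewrite -[witt_add _ _]/(witt_class (Defs.oppf f) + witt_class f) => ->.
  exact/metabolic_class/metabolic_sub.
rewrite -gram_classE; apply: gram_class_congruent.
  by apply: diag_axiom; rewrite all_map; apply: sub_all es => x; exact: eps_symN.
rewrite /= ef.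
apply: congruent_trans (congruent_diag_mx (n := size s) (f := fun i => - s`_i) _ _ _) _.
- by rewrite size_map.
- by move=> i; rewrite (nth_map 0).
suff -> : diag_mx (\row_(i < size s) - s`_i) = - diagm s by exact: congruent_refl.
by apply/matrixP => i j; rewrite !mxE mulNrn.
Qed.

End GramClasses.

(** * Isotropic hermitian forms *)

Section IsotropicReduction.
Variables (F : unitRingType) (divF : is_division_ring F) (rho : involution F).
Hypothesis two0 : (2 : F) != 0.
Local Notation "A ^*" := (adjmx rho A) : ring_scope.
Local Notation eps_gram := (eps_gram rho false).
Local Notation mxg A := (Tagged (fun n => 'M[F]_n) A : gram F).

Lemma eps_sym1 : eps_sym rho false 1.
Proof. by rewrite /eps_sym invol1 expr0 mul1r eqxx oner_neq0. Qed.

(** A nonzero isotropic vector v has a partner w' with h(v, w') = 1 and h(w', w') = 0. Then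
    w' + v / 2 and w' - v / 2 are orthogonal and have the values 1 and -1, so that <1, -1>
    splits off, and its class is 0. *)
Lemma isotropic_reduction n (A : 'M[F]_n) (v : 'rV_n) :
  eps_gram A -> v != 0 -> v *m A *m v^* = 0 ->
  exists m (C : 'M[F]_m), [/\ (m < n)%N, eps_gram C &
    gram_class rho false (mxg A) = gram_class rho false (mxg C)].
Proof.
case: n => [|n] in A v *; first by move=> _ /eqP[]; apply/matrixP => ? -[].
rewrite -[n.+1]/(1 + n)%N in A v * => gA v0 vv.
have sA : A^* = A by have := gA.1; rewrite expr0 scale1r.
have [w vw] : exists w : 'rV_(1 + n), v *m A *m w^* = 1%:M.
  have vA0 : v *m A != 0.
    have [B [AB _]] := gA.2; apply: contra_neq v0 => vA0.
    by rewrite -[v]mulmx1 -AB mulmxA vA0 mul0mx.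
  have [j vj] : exists j, (v *m A) 0 j != 0.
    apply/existsP; apply: contra_neqT vA0; rewrite negb_exists => /forallP vA0.
    by apply/rowP => j; rewrite [RHS]mxE; apply/eqP/negPn; exact: vA0.
  exists (delta_mx j 0 *m ((v *m A) 0 j)^-1%:M)^*; rewrite adjmxK mulmxA -colE.
  have ea : col j (v *m A) 0 0 = (v *m A) 0 j by rewrite mxE.
  apply: mx11P; rewrite mxE big_ord1 ea [_%:M 0 0]mxE [RHS]mxE !eqxx !mulr1n.
  by rewrite mulrV ?divF.
have wv : w *m A *m v^* = 1%:M.
  by rewrite -(adjmx1 rho) -vw !adjmxM adjmxK sA mulmxA.
have [h [hh rh ch]] := central_half divF rho two0.
have adjh m p (B : 'M[F]_(m, p)) : (h *: B)^* = h *: B^*.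
  by apply/matrixP => i j; rewrite !mxE involM rh ch.
have mulh m p q (B : 'M[F]_(m, p)) (C : 'M_(p, q)) : B *m (h *: C) = h *: (B *m C).
  apply/matrixP => i j; rewrite !mxE mulr_sumr; apply: eq_bigr => l _.
  by rewrite mxE mulrA -ch -mulrA.
pose q := w *m A *m w^*.
have sq : q^* = q by rewrite /q !adjmxM adjmxK sA mulmxA.
(* Subtracting half of h(w, w) v makes the partner w of v isotropic. *)
pose w' := w - h *: (q *m v).
have vw' : v *m A *m w'^* = 1%:M.
  by rewrite adjmxB adjh adjmxM mulmxBr vw mulh mulmxA vv mul0mx scaler0 subr0.
have w'v : w' *m A *m v^* = 1%:M.
  by rewrite -(adjmx1 rho) -vw' !adjmxM adjmxK sA mulmxA.
have w'w' : w' *m A *m w'^* = 0.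
  rewrite {1}/w' mulmxBl mulmxBl -!scalemxAl -(mulmxA q) -(mulmxA q) vw' mulmx1.
  rewrite adjmxB adjh adjmxM sq mulmxBr -/q mulh mulmxA wv mul1mx.
  by rewrite -addrA -opprD -scalerDl hh scale1r subrr.
clearbody w'; clear w vw wv q sq.
pose w1 := w' + h *: v; pose w2 := w' - h *: v.
have vv1 : w1 *m A *m w1^* = 1%:M.
  rewrite /w1 adjmxD adjh !mulmxDl !mulmxDr w'w' add0r !mulh -!scalemxAl vv vw' w'v.
  by rewrite !scaler0 addr0 -scalerDl hh scale1r.
have vv2 : w2 *m A *m w2^* = - 1%:M.
  rewrite /w2 adjmxB adjh !mulmxBl !mulmxBr w'w' sub0r !mulh -!scalemxAl vv vw' w'v.
  by rewrite !scaler0 subr0 -opprD -scalerDl hh scale1r.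
have vv21 : w2 *m A *m w1^* = 0.
  rewrite /w1 /w2 adjmxD adjh !mulmxBl !mulmxDr w'w' add0r !mulh -!scalemxAl vv vw' w'v.
  by rewrite !scaler0 addr0 subrr.
clearbody w1 w2; clear w' vw' w'v w'w' vv v0 v.
have [|P [C [[Q [PQ QP]] uP gC PAP]]] := split_vector divF (v := w1) gA.
  by rewrite vv1 mxE eqxx oner_neq0.
have ew2 : w2 = w2 *m Q *m P by rewrite -mulmxA QP mulmx1.
have PAw : lsubmx (w2 *m Q) = 0.
  have e : w2 *m A *m P^* = w2 *m Q *m block_mx 1%:M 0 0 C.
    by rewrite -vv1 -PAP [in LHS]ew2 !mulmxA.
  have lP : lsubmx P^* = w1^* by rewrite -uP; apply/matrixP => i j; rewrite !mxE.
  have : lsubmx (w2 *m Q *m block_mx (1%:M : 'M_1) 0 0 C) = lsubmx (w2 *m Q).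
    by rewrite -{1}[w2 *m Q]hsubmxK mul_row_block !mulmx1 mulmx0 addr0 row_mxKl.
  by rewrite -e -mulmx_lsub lP vv21.
(* As w2 is orthogonal to w1, it lies in the complement C; r are its coordinates there. *)
pose r := rsubmx (w2 *m Q).
have rr : r *m C *m r^* = - 1%:M.
  have ez : w2 *m Q = row_mx 0 r by rewrite -[LHS]hsubmxK PAw.
  have -> : - 1%:M = row_mx 0 r *m (P *m A *m P^*) *m (row_mx 0 r)^*.
    by rewrite -vv2 {1 2}ew2 adjmxM ez !mulmxA.
  rewrite PAP adjmx_row adjmx0 mul_row_block mul_row_col.
  by rewrite !mul0mx !mulmx0 !add0r.
have rr0 : (r *m C *m r^*) 0 0 != 0 by rewrite rr !mxE oppr_eq0 oner_neq0.
case: n => [|n] in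
    A gA sA w1 w2 vv1 vv2 vv21 P C Q PQ QP uP gC PAP ew2 PAw r rr rr0 *.
  by move: rr0; rewrite (_ : r = 0) ?mul0mx ?mxE ?eqxx //; apply/matrixP => ? -[].
rewrite -[n.+1]/(1 + n)%N in
    A gA sA w1 w2 vv1 vv2 vv21 P C Q PQ QP uP gC PAP ew2 PAw r rr rr0 *.
have [P' [C' [iP' _ gC' PCP]]] := split_vector divF gC rr0.
exists n, C'; split=> //.
have g1 : eps_gram (1%:M : 'M_1) by apply/eps_gram11 => //; exact: eps_sym1.
have gN1 : eps_gram (- 1%:M : 'M_1).
  by rewrite -raddfN; apply/eps_gram11 => //; exact/eps_symN/eps_sym1.
have cA : congruent rho A (block_mx (1%:M : 'M_1) 0 0 C).
  by apply: congruent_sym; exists P; [exists Q | rewrite PAP vv1].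
have cC : congruent rho C (block_mx (- 1%:M : 'M_1) 0 0 C').
  by apply: congruent_sym; exists P'; rewrite ?PCP ?rr.
rewrite (@gram_class_congruent _ rho false (mxg A) (sumg (mxg 1%:M) (mxg C)) gA cA).
rewrite gram_class_sum //.
rewrite (@gram_class_congruent _ rho false (mxg C) (sumg (mxg (- 1%:M)) (mxg C')) gC cC).
rewrite gram_class_sum // addrCA addrA.
pose f : epsform rho false := mkform (g1 : form_axiom rho false (mxg 1%:M)).
have := metabolic_class (metabolic_sub f); rewrite -gram_classE gram_class_sum //.
by move=> ->; rewrite add0r.
Qed.

End IsotropicReduction.

(** * Alternating forms *)

Section Alternating.
Variable F : fieldType.
Hypothesis two0 : (2 : F) != 0.
Local Notation rho := (id_involution F).
Local Notation eps_gram := (eps_gram rho true).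
Local Notation mxg A := (Tagged (fun n => 'M[F]_n) A : gram F).

Lemma field_division : is_division_ring F.
Proof. by move=> d d0; rewrite unitfE. Qed.

Lemma alternating_diag n (A : 'M[F]_n) i : eps_gram A -> A i i = 0.
Proof.
case=> /matrixP/(_ i i); rewrite !mxE /= expr1 mulN1r => e _; apply/eqP.
apply: contraTT two0 => a0; rewrite negbK -(mulIr_eq0 _ (mulIf a0)) mulr_natl mulr2n.
by rewrite {1}e addNr.
Qed.

(** The first basis vector has a partner; both span a hyperbolic plane, which splits off. *)
Lemma alternating_class n (A : 'M[F]_n) : eps_gram A -> gram_class rho true (mxg A) = 0.
Proof.
elim: n {-2}n (leqnn n) A => [|N IHN] [|[|n]] // lenN A gA.
- apply: (@metabolic_gram_class _ rho true (mxg A) 0 0 0 0 gA).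
  by apply: (@congruent_reindex _ _ _ _ id); [exists id | case].
- apply: (@metabolic_gram_class _ rho true (mxg A) 0 0 0 0 gA).
  by apply: (@congruent_reindex _ _ _ _ id); [exists id | case].
- by have /invertible_mx11_neq0 := gA.2; rewrite alternating_diag // eqxx.
rewrite -[n.+2]/(1 + (1 + n))%N in A gA *; set b := ursubmx A.
have b0 : b != 0.
  have [B [AB _]] := gA.2; apply: contra_eq_neq AB => b0.
  have uA : usubmx A = 0.
    rewrite -[usubmx A]hsubmxK -/(ursubmx A) -/b b0.
    suff -> : lsubmx (usubmx A) = 0 by rewrite row_mx0.
    by apply/matrixP => i j; rewrite !ord1 !mxE; exact: alternating_diag.
  apply/eqP => /(congr1 usubmx); rewrite -mul_usub_mx uA mul0mx scalar_mx_block col_mxKu.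
  by move/matrixP/(_ 0 (lshift _ 0)); rewrite row_mxEl !mxE /= => /eqP; rewrite eq_sym oner_eq0.
have [U [U' [UU' U'U]] uU] := extend_row field_division b0.
(* A change of the last basis vectors makes the first row (0, 1, 0, ..., 0). *)
pose P : 'M[F]_(1 + (1 + n)) := block_mx 1%:M 0 0 (adjmx rho U').
have iP : invertible_mx P.
  apply: invertible_block_triangular; first exact: invertible1.
  by apply: invertible_adjmx; exists U.
have gM := eps_gramJ gA iP; set M := P *m A *m adjmx rho P in gM.
have urM : ursubmx M = row_mx 1%:M 0.
  rewrite /M /P -{1}[A]submxK adjmx_block !mulmx_block !adjmx0 adjmxK -/b.
  rewrite !mulmx0 !mul0mx !addr0 !mul1mx ?add0r block_mxKur -uU.
  by rewrite mul_usub_mx UU' scalar_mx_block col_mxKu.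
have cM : congruent rho A M by apply: congruent_sym; exists P.
have {}urM : M 0 (rshift 1 (lshift n 0)) = 1.
  have /matrixP/(_ 0 (lshift n 0)) := urM; rewrite row_mxEl mxE [LHS]mxE [RHS]mxE => e.
  by rewrite -[RHS]e; congr (M _ _); apply: val_inj.
clearbody M; rewrite -[(1 + (1 + n))%N]/((1 + 1) + n)%N in M gM urM cM.
pose X : 'M[F]_(1 + 1) := ulsubmx M.
have X01 : X 0 (rshift 1 0) = 1.
  by rewrite !mxE -urM; congr (M _ _); apply: val_inj.
have X10 : X (rshift 1 0) 0 = -1.
  have /matrixP/(_ (lshift n (rshift 1 0)) (lshift n 0)) := gM.1.
  by rewrite !mxE /= expr1 mulN1r => e; rewrite -X01 !mxE e opprK.
have eX : X = block_mx (0 : 'M_1) 1%:M (- 1%:M) (0 : 'M_1).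
  apply/matrixP => i j; case: (split_ordP i) => i' ->; case: (split_ordP j) => j' ->;
    rewrite !ord1 ?block_mxEul ?block_mxEur ?block_mxEdl ?block_mxEdr.
  - by rewrite 2!mxE [RHS]mxE; exact: alternating_diag.
  - by rewrite [RHS]mxE -X01; congr (X _ _); apply: val_inj.
  - by rewrite [RHS]mxE [Y in - Y]mxE -X10; congr (X _ _); apply: val_inj.
  - by rewrite 2!mxE [RHS]mxE; exact: alternating_diag.
have iX : invertible_mx X.
  exists (- X); rewrite !mulmxN !mulNmx eX mulmx_block !mulmx0 !mul0mx !mul1mx !mulmx1 addr0 !add0r.
  by rewrite opp_block_mx !opprK !oppr0 addr0 opprK -scalar_mx_block.
have [c _ ec] := block_elimination gM.1 iX.
set C := drsubmx M + _ in ec; set L := block_mx _ _ _ _ in ec.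
have cL : congruent rho A (block_mx X 0 0 C).
  apply: (congruent_trans cM); apply: congruent_sym; exists L => //.
  by apply: invertible_block_lower; exact: invertible1.
have [gX gC] : eps_gram X /\ eps_gram C by apply/eps_gram_block/(eps_gram_congr cL).
rewrite (@gram_class_congruent _ rho true (mxg A) (sumg (mxg X) (mxg C)) gA cL).
rewrite gram_class_sum //.
rewrite (@metabolic_gram_class _ rho true (mxg X) 1 1%:M (- 1%:M) 0 gX); last first.
  by rewrite /= eX; exact: congruent_refl.
by rewrite add0r IHN //; exact: ltnW.
Qed.

Lemma witt_alternating (w : witt rho true) : w = 0.
Proof.
rewrite -(witt_reprK w) -gram_classE; case: (repr w) => -[n A] /= /asboolP gA.
exact: alternating_class.
Qed.

End Alternating.

(** * Valuations and square roots *)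

Section Valuation.
Variables (K : fieldType) (nu : normalized_valuation K).
Local Notation val_ge := (val_ge nu).

Lemma nu1 : nu 1 = 0.
Proof.
have n1 : (1 : K) != 0 by exact: oner_neq0.
by have := Defs.valM nu n1 n1; rewrite mulr1; lia.
Qed.

Lemma nuN c : c != 0 -> nu (- c) = nu c.
Proof.
have n0 : (-1 : K) != 0 by rewrite oppr_eq0 oner_eq0.
have := Defs.valM nu n0 n0; rewrite mulrNN mulr1 nu1 => e c0.
by rewrite -mulN1r Defs.valM //; lia.
Qed.

Lemma nuV c : c != 0 -> nu c^-1 = - nu c.
Proof.
by move=> c0; have := Defs.valM nu c0 (invr_neq0 c0); rewrite divff // nu1; lia.
Qed.

Lemma nuX c n : c != 0 -> nu (c ^+ n) = n%:Z * nu c.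
Proof.
move=> c0; elim: n => [|n IHn]; first by rewrite expr0 nu1 mul0r.
by rewrite exprS Defs.valM ?expf_neq0 // IHn; lia.
Qed.

Lemma val_ge0 N : val_ge N 0.
Proof. by rewrite /Defs.val_ge eqxx. Qed.

Lemma val_geE N c : c != 0 -> val_ge N c = (N <= nu c).
Proof. by rewrite /Defs.val_ge => /negPf ->. Qed.

Lemma val_geW M N c : M <= N -> val_ge N c -> val_ge M c.
Proof. by rewrite /Defs.val_ge; case: eqP => //= _; lia. Qed.

Lemma val_geD N c d : val_ge N c -> val_ge N d -> val_ge N (c + d).
Proof.
have [->|c0] := eqVneq c 0; first by rewrite add0r.
have [->|d0] := eqVneq d 0; first by rewrite addr0.
have [->|cd0] := eqVneq (c + d) 0; first by rewrite val_ge0.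
rewrite !val_geE //; have := Defs.valD nu c0 d0 cd0.
by rewrite ge_min => /orP[] le Nc Nd; apply: le_trans le.
Qed.

Lemma val_geN N c : val_ge N (- c) = val_ge N c.
Proof. by rewrite /Defs.val_ge oppr_eq0; case: eqP => //= /eqP c0; rewrite nuN. Qed.

Lemma val_geB N c d : val_ge N c -> val_ge N d -> val_ge N (c - d).
Proof. by move=> gc gd; rewrite val_geD // val_geN. Qed.

Lemma val_geM M N c d : val_ge M c -> val_ge N d -> val_ge (M + N) (c * d).
Proof.
have [->|c0] := eqVneq c 0; first by rewrite mul0r !val_ge0.
have [->|d0] := eqVneq d 0; first by rewrite mulr0 !val_ge0.
by rewrite !val_geE ?mulf_neq0 // Defs.valM //; lia.
Qed.

Lemma val_geMO N c d : val_ge 0 c -> val_ge N d -> val_ge N (c * d).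
Proof. by move=> gc gd; rewrite -[N]add0r val_geM. Qed.

Lemma val_ge1 : val_ge 0 1.
Proof. by rewrite val_geE ?oner_neq0 // nu1. Qed.

Lemma val_ge_eq0 c : (forall N, val_ge N c) -> c = 0.
Proof.
move=> gc; apply/eqP/negPn/negP => c0.
by have := gc (nu c + 1); rewrite val_geE //; lia.
Qed.

Lemma val_idealE c : val_ideal nu c = val_ge 1 c.
Proof. by rewrite /val_ideal /Defs.val_ge; case: eqP => //= _; lia. Qed.

Lemma val_unit_ring c : val_unit nu c -> val_ge 0 c.
Proof. by case/andP=> c0 /eqP e; rewrite val_geE // e. Qed.

Lemma val_unitM c d : val_unit nu c -> val_unit nu d -> val_unit nu (c * d).
Proof.
by case/andP=> c0 /eqP e /andP[d0 /eqP f]; rewrite /val_unit mulf_neq0 // Defs.valM // e f.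
Qed.

Lemma val_unitN c : val_unit nu (- c) = val_unit nu c.
Proof. by rewrite /val_unit oppr_eq0; case: eqP => //= /eqP c0; rewrite nuN. Qed.

Lemma val_unitV c : val_unit nu c -> val_unit nu c^-1.
Proof. by case/andP=> c0 /eqP e; rewrite /val_unit invr_eq0 c0 nuV // e. Qed.

(** Terms of distinct valuation cannot cancel. *)
Lemma val_ge_subr N c d : c != 0 -> d != 0 -> nu c != nu d ->
  val_ge N (c - d) -> val_ge N c /\ val_ge N d.
Proof.
have lt u v : u != 0 -> v != 0 -> nu u < nu v -> val_ge N (u - v) -> val_ge N u /\ val_ge N v.
  move=> u0 v0 uv guv; rewrite !val_geE //.
  suff uN : N <= nu u by split; lia.
  rewrite leNgt; apply/negP => uN.
  have : val_ge (nu u + 1) (u - v + v).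
    by apply: val_geD; [apply: val_geW guv; lia | rewrite val_geE //; lia].
  by rewrite addrNK val_geE //; lia.
move=> c0 d0 cd; have [/lt|] := ltP (nu c) (nu d); first exact.
move=> dc; rewrite -val_geN opprB => g.
by case: (lt d c) => //; lia.
Qed.

Section Residue.
Variables (k : fieldType) (redK : K -> k).
Hypothesis redK_res : residue_map (val_ring nu) (val_ideal nu) redK.

Lemma redK1 : redK 1 = 1. Proof. exact: red1 redK_res. Qed.

Lemma redKD c d : val_ge 0 c -> val_ge 0 d -> redK (c + d) = redK c + redK d.
Proof. exact: (redD redK_res). Qed.

Lemma redKM c d : val_ge 0 c -> val_ge 0 d -> redK (c * d) = redK c * redK d.
Proof. exact: (redM redK_res). Qed.

Lemma redK_eq0 c : val_ge 0 c -> (redK c == 0) = val_ge 1 c.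
Proof.
move=> gc; rewrite -val_idealE; apply/eqP/idP => [/(red_ker redK_res gc)//|].
by move/(red_ker redK_res gc).
Qed.

Lemma redK0 : redK 0 = 0.
Proof. by apply/eqP; rewrite redK_eq0 ?val_ge0. Qed.

Lemma redKN c : val_ge 0 c -> redK (- c) = - redK c.
Proof.
move=> gc; apply/eqP; rewrite -addr_eq0 -redKD ?val_geN //.
by rewrite addNr redK0.
Qed.

Lemma redKB c d : val_ge 0 c -> val_ge 0 d -> redK (c - d) = redK c - redK d.
Proof. by move=> gc gd; rewrite redKD ?redKN ?val_geN. Qed.

Lemma val_unitE c : val_unit nu c = val_ge 0 c && (redK c != 0).
Proof.
apply/idP/andP => [uc|[gc]].
  have gc := val_unit_ring uc; rewrite redK_eq0 //.
  by case/andP: uc => c0 /eqP e; rewrite !val_geE // e.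
rewrite redK_eq0 // /val_unit; move: gc; rewrite /Defs.val_ge.
by case: eqP => //= _; lia.
Qed.

Lemma redK_lift (r : k) : exists2 c, val_ge 0 c & redK c = r.
Proof. exact: (red_surj redK_res). Qed.

Lemma redK_lift_unit (r : k) : r != 0 -> exists2 c, val_unit nu c & redK c = r.
Proof. by have [c gc <-] := redK_lift r => r0; exists c; rewrite ?val_unitE ?gc. Qed.

Section Hensel.
Hypothesis k_char : 2%N \notin [pchar k].

Lemma two_k : (2 : k) != 0.
Proof. by move: k_char; rewrite inE. Qed.

Lemma val_unit2 : val_unit nu 2.
Proof.
have g2 : val_ge 0 2 by apply: val_geD; exact: val_ge1.
by rewrite val_unitE g2 redKD ?val_ge1 // redK1 -mulr2n two_k.
Qed.

Hypothesis K_complete : complete_valuation nu.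

(** 1 + c = (1 + t)^2 means t = (c - t^2) / 2, and the right-hand side is a contraction of
    the maximal ideal. *)
Lemma hensel_sqrt c : val_ge 1 c -> exists s, s ^+ 2 = 1 + c.
Proof.
move=> gc; have u2 := val_unit2; have g2 := val_unit_ring (val_unitV u2).
have two0 : (2 : K) != 0 by case/andP: u2.
pose f t := 2^-1 * (c - t ^+ 2); pose u n := iter n f 0.
have gu n : val_ge 1 (u n).
  elim: n => [|n IHn]; first exact: val_ge0.
  apply: val_geMO => //; apply: val_geB => //.
  by rewrite expr2; apply: val_geW (val_geM IHn IHn).
have step n : val_ge (n%:Z + 1) (u n.+1 - u n).
  elim: n => [|n IHn]; first by rewrite subr0; exact: (gu 1%N).
  have -> : u n.+2 - u n.+1 = 2^-1 * ((u n - u n.+1) * (u n.+1 + u n)).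
    by rewrite /u !iterS -/(u n) /f; ring.
  apply: val_geMO => //; apply: (@val_geW _ (n%:Z + 1 + 1)); first by lia.
  apply: val_geM; first by rewrite -opprB val_geN.
  by apply: val_geD; exact: gu.
have cauchy n j : val_ge (n%:Z + 1) (u (n + j)%N - u n).
  elim: j => [|j IHj]; first by rewrite addn0 subrr val_ge0.
  have -> : u (n + j.+1)%N - u n = (u (n + j).+1 - u (n + j)%N) + (u (n + j)%N - u n).
    by rewrite addnS; ring.
  by apply: val_geD => //; apply: val_geW (step (n + j)%N); lia.
have [l ul] : exists l, forall N : int, exists n0 : nat,
    forall n, (n0 <= n)%N -> val_ge N (u n - l).
  apply: K_complete => N; exists `|N|%N => m n mN nN.
  have -> : u m - u n = (u m - u `|N|%N) - (u n - u `|N|%N) by ring.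
  apply: val_geB.
    by rewrite -(subnKC mN); apply: val_geW (cauchy _ _); lia.
  by rewrite -(subnKC nN); apply: val_geW (cauchy _ _); lia.
have gl : val_ge 1 l.
  have [n0 /(_ n0 (leqnn _)) g] := ul 1.
  have -> : l = u n0 - (u n0 - l) by ring.
  exact: val_geB.
exists (1 + l); apply/eqP; rewrite -subr_eq0; apply/eqP/val_ge_eq0 => N.
have [n0 g] := ul N; have g1 := g n0 (leqnn _); have g2' := g n0.+1 (leqnSn _).
have -> : (1 + l) ^+ 2 - (1 + c) = - (2 * (u n0.+1 - l)) + (u n0 + l) * (l - u n0).
  have e : 2 * u n0.+1 = c - u n0 ^+ 2 by rewrite /u iterS /f mulVKf.
  rewrite mulrBr e; ring.
apply: val_geD; first by rewrite val_geN; apply: val_geMO => //; exact: val_unit_ring.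
apply: val_geMO; last by rewrite -opprB val_geN.
by apply: (@val_geW _ 1) => //; apply: val_geD.
Qed.

(** The quotient d / c is congruent to 1, hence a square. *)
Lemma hensel_ratio c d : val_unit nu c -> val_unit nu d -> redK c = redK d ->
  exists2 s, s != 0 & d = s ^+ 2 * c.
Proof.
move=> uc ud e; have c0 : c != 0 by case/andP: uc.
have gd : val_ge 1 (d - c).
  by rewrite -redK_eq0 ?val_geB ?redKB ?val_unit_ring // e subrr.
have [s es] : exists s, s ^+ 2 = 1 + c^-1 * (d - c).
  by apply: hensel_sqrt; apply: val_geMO => //; exact/val_unit_ring/val_unitV.
have ed : d = s ^+ 2 * c by rewrite es mulrDl mul1r mulrAC mulVf // mul1r addrC subrK.
exists s => //; apply: contraTneq ud => s0.
by rewrite ed s0 expr0n mul0r /val_unit eqxx.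
Qed.

End Hensel.
End Residue.
End Valuation.

(** * The valuation of the quaternion algebra *)

Section Larmour.
Variables (K : fieldType) (nu : normalized_valuation K) (K_complete : complete_valuation nu).
Variables (k : fieldType) (redK : K -> k).
Hypothesis redK_res : residue_map (val_ring nu) (val_ideal nu) redK.
Hypothesis k_char : 2%N \notin [pchar k].
Variables (a pi : K).
Hypothesis a_unit : val_unit nu a.
Hypothesis pi_unif : pi != 0 /\ nu pi = 1.
Hypothesis D_div : is_division_ring (quaternion a pi).
Local Notation D := (quaternion a pi).
Local Notation O := (@quat_val_ring K nu a pi).
Local Notation Cj := (canonical_involution a pi).
Local Notation x := (qx a pi).
Local Notation y := (qy a pi).
Local Notation val_ge := (val_ge nu).
Local Notation diagm s := (tagged (diagg s)).

Lemma opp_fixed (c : K) : c = - c -> c = 0.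
Proof.
have two0 : (2 : K) != 0 by case/andP: (val_unit2 redK_res k_char).
move=> e; apply/eqP; move: two0; apply: contraTT => c0.
by rewrite negbK -(mulIr_eq0 _ (mulIf c0)) mulr_natl mulr2n {1}e addNr.
Qed.

Lemma Nrd_eq0 (d : D) : (Nrd d == 0) = (d == 0).
Proof.
apply/idP/eqP => [|->]; last by rewrite /Nrd /=; apply/eqP; ring.
by apply: contraTeq => /D_div.
Qed.

(** A square root of abar would lift to a square root r of a, and then r - x would be a
    zero divisor of D. *)
Lemma residue_nonsquare (r : k) : r ^+ 2 != redK a.
Proof.
apply/eqP => ra; have [c gc er] := redK_lift redK_res r.
have uc : val_unit nu c.
  rewrite (val_unitE redK_res) gc er /=; apply: contraTneq a_unit => r0.
  by rewrite (val_unitE redK_res) -ra r0 expr0n eqxx andbF.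
have [|s s0 ea] := hensel_ratio redK_res k_char K_complete (val_unitM uc uc) a_unit.
  by rewrite (redKM redK_res) // er -expr2.
have /D_div : Quat a pi (s * c) (-1) 0 0 != 0.
  by apply/eqP => -[_ /eqP]; rewrite oppr_eq0 oner_eq0.
rewrite -[_ \is a _]/(Nrd _ != 0) /Nrd /= => /negP; apply; apply/eqP.
rewrite [in a * _]ea; ring.
Qed.

(** Dividing by the square of the coordinate of least valuation leaves q^2 - a, or 1 - a q^2
    with q in the maximal ideal; this is a unit because abar is not a square. *)
Lemma pair_norm_val (s t : K) : (s != 0) || (t != 0) ->
  exists M : int, [/\ s ^+ 2 - a * t ^+ 2 != 0, nu (s ^+ 2 - a * t ^+ 2) = M + M,
                     val_ge M s & val_ge M t].
Proof.
have ga := val_unit_ring a_unit.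
have scale r v : r != 0 -> val_unit nu v -> v * r ^+ 2 != 0 /\ nu (v * r ^+ 2) = nu r + nu r.
  move=> r0 /andP[v0 /eqP ev]; rewrite mulf_neq0 ?expf_neq0 //.
  by rewrite Defs.valM ?expf_neq0 // ev add0r expr2 Defs.valM.
have byt : t != 0 -> val_ge (nu t) s ->
    s ^+ 2 - a * t ^+ 2 != 0 /\ nu (s ^+ 2 - a * t ^+ 2) = nu t + nu t.
  move=> t0 gs; have gq : val_ge 0 (s / t).
    by rewrite -(subrr (nu t)); apply: val_geM gs _; rewrite val_geE ?invr_neq0 // nuV.
  have -> : s ^+ 2 - a * t ^+ 2 = ((s / t) ^+ 2 - a) * t ^+ 2 by field.
  apply: scale => //; have gq2 := val_geMO gq gq.
  rewrite (val_unitE redK_res) expr2 val_geB //= (redKB redK_res) // (redKM redK_res) //.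
  by rewrite subr_eq0 -expr2 residue_nonsquare.
have bys : s != 0 -> val_ge (nu s + 1) t ->
    s ^+ 2 - a * t ^+ 2 != 0 /\ nu (s ^+ 2 - a * t ^+ 2) = nu s + nu s.
  move=> s0 gt; have gq : val_ge 1 (t / s).
    rewrite [1](_ : _ = nu s + 1 + - nu s); last by lia.
    by apply: val_geM gt _; rewrite val_geE ?invr_neq0 // nuV.
  have -> : s ^+ 2 - a * t ^+ 2 = (1 - a * (t / s) ^+ 2) * s ^+ 2 by field.
  apply: scale => //; have gq0 := val_geW (isT : 0 <= 1 :> int) gq.
  have g2 : val_ge 1 (a * (t / s) ^+ 2) by apply: val_geMO => //; exact: val_geMO.
  have g20 := val_geW (isT : 0 <= 1 :> int) g2.
  rewrite (val_unitE redK_res) val_geB ?val_ge1 //= (redKB redK_res) ?val_ge1 //.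
  have /eqP -> : redK (a * (t / s) ^+ 2) == 0 by rewrite (redK_eq0 redK_res).
  by rewrite subr0 (redK1 redK_res) oner_neq0.
have [t0|t0] := eqVneq t 0.
  rewrite orbF => s0; have [|n0 en] := bys s0; first by rewrite t0 val_ge0.
  by exists (nu s); split=> //; [rewrite val_geE | rewrite t0 val_ge0].
have [s0|s0] := eqVneq s 0.
  move=> _; have [|n0 en] := byt t0; first by rewrite s0 val_ge0.
  by exists (nu t); split=> //; [rewrite s0 val_ge0 | rewrite val_geE].
move=> _; have [le|lt] := leP (nu t) (nu s).
  have [|n0 en] := byt t0; first by rewrite val_geE.
  by exists (nu t); split; rewrite ?val_geE.
have [|n0 en] := bys s0; first by rewrite val_geE //; lia.
by exists (nu s); split; rewrite ?val_geE //; lia.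
Qed.

Lemma Nrd_pair (d : D) :
  Nrd d = (qc0 d ^+ 2 - a * qc1 d ^+ 2) - pi * (qc2 d ^+ 2 - a * qc3 d ^+ 2).
Proof. by rewrite /Nrd; ring. Qed.

(** The contribution of K(x) to Nrd d has even valuation and that of K(x) y odd valuation,
    so they do not cancel. *)
Lemma val_Nrd (N : int) (d : D) : val_ge N (Nrd d) ->
  (exists M : int, [/\ N <= M + M, val_ge M (qc0 d) & val_ge M (qc1 d)]) /\
  exists M : int, [/\ N <= M + M + 1, val_ge M (qc2 d) & val_ge M (qc3 d)].
Proof.
have [pi0 epi] := pi_unif.
have zero s t : ~~ ((s != 0) || (t != 0)) -> s = 0 /\ t = 0.
  by rewrite negb_or !negbK => /andP[/eqP -> /eqP ->].
rewrite Nrd_pair; set c0 := qc0 d; set c1 := qc1 d; set c2 := qc2 d; set c3 := qc3 d.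
set u := _ - a * c1 ^+ 2; set w := _ - a * c3 ^+ 2 => g.
have [gu gw] : val_ge N u /\ val_ge N (pi * w).
  have [u0|u0] := eqVneq u 0.
    by move: g; rewrite u0 sub0r val_geN => ->; rewrite val_ge0.
  have [w0|w0] := eqVneq w 0.
    by move: g; rewrite w0 mulr0 subr0 => ->; rewrite val_ge0.
  apply: val_ge_subr g => //; first by rewrite mulf_neq0.
  rewrite Defs.valM // epi.
  have [|M [_ -> _ _]] := @pair_norm_val c0 c1.
    by apply: contraNT u0 => /zero[e0 e1]; rewrite /u e0 e1; apply/eqP; ring.
  have [|M' [_ -> _ _]] := @pair_norm_val c2 c3.
    by apply: contraNT w0 => /zero[e0 e1]; rewrite /w e0 e1; apply/eqP; ring.
  by lia.
split.
  have [nz|/zero[-> ->]] := boolP ((c0 != 0) || (c1 != 0)).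
    have [M [u0 eu gs gt]] := pair_norm_val nz.
    by exists M; split=> //; move: gu; rewrite val_geE // eu.
  by exists `|N|; split; rewrite ?val_ge0 //; lia.
have [nz|/zero[-> ->]] := boolP ((c2 != 0) || (c3 != 0)).
  have [M [w0 ew gs gt]] := pair_norm_val nz.
  by exists M; split=> //; move: gw; rewrite val_geE ?mulf_neq0 // Defs.valM // epi ew; lia.
by exists `|N|; split; rewrite ?val_ge0 //; lia.
Qed.

Lemma quat_val_ring_Nrd (d : D) : quat_val_ring nu d = val_ge 0 (Nrd d).
Proof.
rewrite /quat_val_ring /Defs.val_ge -Nrd_eq0; congr (_ || _).
by rewrite /nuD pmulr_lge0 ?ler0z // invr_gt0.
Qed.

Lemma quat_val_ideal_Nrd (d : D) : quat_val_ideal nu d = val_ge 1 (Nrd d).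
Proof.
rewrite -val_idealE /quat_val_ideal /val_ideal -Nrd_eq0; congr (_ || _).
by rewrite /nuD pmulr_lgt0 ?ltr0z // invr_gt0.
Qed.

Lemma quat_val_ringE (d : D) :
  quat_val_ring nu d =
  [&& val_ge 0 (qc0 d), val_ge 0 (qc1 d), val_ge 0 (qc2 d) & val_ge 0 (qc3 d)].
Proof.
have [pi0 epi] := pi_unif; have ga := val_unit_ring a_unit.
have gpi : val_ge 1 pi by rewrite val_geE // epi.
rewrite quat_val_ring_Nrd; apply/idP/and4P.
  case/val_Nrd => [[M [leM g0 g1]] [M' [leM' g2 g3]]].
  have {}leM : 0 <= M by lia.
  have {}leM' : 0 <= M' by lia.
  by split; [exact: val_geW g0 | exact: val_geW g1 | exact: val_geW g2 | exact: val_geW g3].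
case=> g0 g1 g2 g3; rewrite Nrd_pair; apply: val_geB.
  by apply: val_geB; [|apply: val_geMO => //]; rewrite expr2; apply: val_geMO.
apply: (@val_geW _ _ 0 1) => //; rewrite mulrC; apply: val_geMO => //.
by apply: val_geB; [|apply: val_geMO => //]; rewrite expr2; apply: val_geMO.
Qed.

Lemma quat_val_idealE (d : D) :
  quat_val_ideal nu d =
  [&& val_ge 1 (qc0 d), val_ge 1 (qc1 d), val_ge 0 (qc2 d) & val_ge 0 (qc3 d)].
Proof.
have [pi0 epi] := pi_unif; have ga := val_unit_ring a_unit.
have gpi : val_ge 1 pi by rewrite val_geE // epi.
rewrite quat_val_ideal_Nrd; apply/idP/and4P.
  case/val_Nrd => [[M [leM g0 g1]] [M' [leM' g2 g3]]].
  have {}leM : 1 <= M by lia.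
  have {}leM' : 0 <= M' by lia.
  by split; [exact: val_geW g0 | exact: val_geW g1 | exact: val_geW g2 | exact: val_geW g3].
case=> g0 g1 g2 g3; rewrite Nrd_pair; apply: val_geB.
  apply: val_geB; [|apply: val_geMO => //]; rewrite expr2.
    by apply: val_geMO => //; exact: val_geW g0.
  by apply: val_geMO => //; exact: val_geW g1.
rewrite mulrC; apply: val_geMO => //.
by apply: val_geB; [|apply: val_geMO => //]; rewrite expr2; apply: val_geMO.
Qed.

(** * The residue field and the involutions *)

Variables (E : fieldExtType k) (rD : quaternion a pi -> E).
Hypothesis rD_res : residue_map O (@quat_val_ideal K nu a pi) rD.
Hypothesis rD_k : forall c : K, val_ring nu c -> rD c%:A = (redK c)%:A.
Variable iota : involution E.
Hypothesis iota_k : forall c : k, iota c%:A = c%:A.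
Hypothesis iota_nontriv : exists e : E, iota e <> e.
Variable tauy : involution D.
Hypothesis tauy_def : forall d, tauy d = conj_by y (canonical_involution a pi) d.
Local Notation X := (rD (qx a pi)).

Lemma O_add d e : O d -> O e -> O (d + e).
Proof.
rewrite !quat_val_ringE => /and4P[d0 d1 d2 d3] /and4P[e0 e1 e2 e3].
by apply/and4P; split; apply: val_geD.
Qed.

Lemma O_mul d e : O d -> O e -> O (d * e).
Proof. by rewrite !quat_val_ring_Nrd NrdM; exact: val_geMO. Qed.

Lemma O_conj d : O d -> O (conjq d).
Proof. by rewrite !quat_val_ringE /= !val_geN. Qed.

Lemma O_opp d : O d -> O (- d).
Proof. by rewrite !quat_val_ringE /= !val_geN. Qed.

Lemma O_scalar c : val_ge 0 c -> O c%:A.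
Proof. by move=> gc; rewrite quat_val_ringE /= mulr1 gc mulr0 val_ge0. Qed.

Lemma O_x : O x.
Proof. by rewrite quat_val_ringE /= !val_ge0 val_ge1. Qed.

Lemma O_0 : O 0. Proof. by rewrite /quat_val_ring eqxx. Qed.

Lemma O_sum (I : Type) (r : seq I) (P : pred I) (f : I -> D) :
  (forall i, P i -> O (f i)) -> O (\sum_(i <- r | P i) f i).
Proof.
by move=> Of; apply: (big_ind (fun d => is_true (O d))) => //; [exact: O_0 | exact: O_add].
Qed.

Lemma rDD d e : O d -> O e -> rD (d + e) = rD d + rD e.
Proof. exact: (redD rD_res). Qed.

Lemma rDM d e : O d -> O e -> rD (d * e) = rD d * rD e.
Proof. exact: (redM rD_res). Qed.

Lemma rD_ideal d : quat_val_ideal nu d -> rD d = 0.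
Proof.
move=> md; apply/(red_ker rD_res) => //.
move: md; rewrite quat_val_ringE quat_val_idealE => /and4P[d0 d1 d2 d3].
by rewrite d2 d3 !andbT; apply/andP; split; [apply: val_geW d0 | apply: val_geW d1].
Qed.

Lemma rD0 : rD 0 = 0.
Proof. by apply: rD_ideal; rewrite /quat_val_ideal eqxx. Qed.

Lemma rD_sum (I : Type) (r : seq I) (P : pred I) (f : I -> D) :
  (forall i, P i -> O (f i)) -> rD (\sum_(i <- r | P i) f i) = \sum_(i <- r | P i) rD (f i).
Proof.
move=> Of; elim: r => [|i r IHr]; first by rewrite !big_nil rD0.
rewrite !big_cons; case Pi: (P i) => //.
by rewrite rDD ?IHr ?Of ?O_sum.
Qed.

(** The components of d on y and z have valuation at least 1/2, so they reduce to 0. *)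
Lemma rD_coord d : O d -> rD d = (redK (qc0 d))%:A + redK (qc1 d) *: X.
Proof.
move=> Od; move: (Od); rewrite quat_val_ringE => /and4P[d0 d1 d2 d3].
have e : d = (qc0 d)%:A + (qc1 d)%:A * x + Quat a pi 0 0 (qc2 d) (qc3 d).
  case: (d) => ? ? ? ?; rewrite !quatopE /quat_add /quat_scale /=; congr Quat; ring.
have m2 : quat_val_ideal nu (Quat a pi 0 0 (qc2 d) (qc3 d)).
  by rewrite quat_val_idealE /= d2 d3 !val_ge0.
have O2 : O (Quat a pi 0 0 (qc2 d) (qc3 d)) by rewrite quat_val_ringE /= d2 d3 !val_ge0.
have O1 : O ((qc1 d)%:A * x) by apply: O_mul; [exact: O_scalar | exact: O_x].
rewrite {1}e rDD ?O_add ?O_scalar // rDD ?O_scalar // (rD_ideal m2) addr0.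
by rewrite rDM ?O_scalar ?O_x // !rD_k // mulr_algl.
Qed.

Lemma two_E : (2 : E) != 0.
Proof.
rewrite -[2](rmorph_nat (in_alg E)) fmorph_eq0.
exact: two_k.
Qed.

Lemma two_D : (2 : D) != 0.
Proof.
apply/eqP => /(congr1 (@qc0 _ _ _)) /= /eqP.
by have /andP[/negPf] := val_unit2 redK_res k_char; rewrite -[2%:R]/(1 + 1) => ->.
Qed.

Lemma rDx_sqr : X ^+ 2 = (redK a)%:A.
Proof.
by rewrite expr2 -rDM ?O_x // qxx rD_k //; exact: val_unit_ring.
Qed.

Lemma E_coord (e : E) : exists c0 c1 : k, e = c0%:A + c1 *: X.
Proof.
have [d Od <-] := red_surj rD_res e.
by exists (redK (qc0 d)), (redK (qc1 d)); exact: rD_coord.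
Qed.

Lemma E_indep (c0 c1 : k) : c0%:A + c1 *: X = 0 -> c0 = 0 /\ c1 = 0.
Proof.
have inj (c d : k) : c%:A = d%:A :> E -> c = d by exact: (fmorph_inj (in_alg E)).
have [-> | c1n0 e] := eqVneq c1 0.
  by rewrite scale0r addr0 -[0](scale0r 1) => /inj.
have eX : X = (- c1^-1 * c0)%:A.
  apply: (scalerI c1n0); rewrite scalerA mulrA mulrN divff // mulN1r scaleNr.
  by apply/eqP; rewrite -addr_eq0 addrC e.
case/eqP: (residue_nonsquare (- c1^-1 * c0)).
by apply: inj; rewrite -rDx_sqr eX; exact: (rmorphXn (in_alg E) 2).
Qed.

Lemma E_free : free [:: 1; X].
Proof.
apply/freeP => c; rewrite !big_ord_recl big_ord0 addr0 /= => /E_indep[c0 c1] i.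
by case: (unliftP 0 i) => [j|] -> //; rewrite [j]ord1.
Qed.

Lemma E_dim : \dim {:E} = 2%N.
Proof.
have e : {:E}%VS = <<[:: 1%R; X]>>%VS.
  apply/eqP; rewrite eqEsubv subvf andbT; apply/subvP => v _.
  have [c0 [c1 ->]] := E_coord v.
  by apply: memvD; apply: memvZ; apply: memv_span; rewrite !inE eqxx ?orbT.
by rewrite e (eqP E_free).
Qed.

Lemma E_adjoin : <<1%VS; X>>%VS = fullv.
Proof.
apply/eqP; rewrite eqEsubv subvf /=; apply/subvP => v _.
have [c0 [c1 ->]] := E_coord v.
by apply: memvD; apply: memvZ; [exact: mem1v | exact: memv_adjoin].
Qed.

(** iota X is a square root of abar, and iota would be the identity if it were X. *)
Lemma iota_coord (c0 c1 : k) : iota (c0%:A + c1 *: X) = c0%:A - c1 *: X.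
Proof.
have iE c0' c1' : iota (c0'%:A + c1' *: X) = c0'%:A + c1' *: iota X.
  by rewrite involD iota_k -[c1' *: X]mulr_algr involM iota_k mulr_algl.
have : (iota X - X) * (iota X + X) == 0.
  by rewrite -subr_sqr subr_eq0 rDx_sqr expr2 -involM -expr2 rDx_sqr iota_k.
rewrite mulf_eq0 subr_eq0 addr_eq0 => /orP[] /eqP eX; last by rewrite iE eX scalerN.
have [e []] := iota_nontriv.
by have [d0 [d1 ->]] := E_coord e; rewrite iE eX.
Qed.

Lemma rD_conj d : O d -> rD (conjq d) = iota (rD d).
Proof.
move=> Od; rewrite (rD_coord (O_conj Od)) (rD_coord Od) iota_coord /=.
by rewrite (redKN redK_res) ?scaleNr //; move: Od; rewrite quat_val_ringE => /and4P[].
Qed.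

Lemma iota_fixed (e : E) : iota e = e -> exists c : k, e = c%:A.
Proof.
have [c0 [c1 ->]] := E_coord e; rewrite iota_coord => /addrI h.
exists c0; have : 0%:A + (c1 + c1) *: X = 0 by rewrite scale0r add0r scalerDl -{1}h addNr.
case/E_indep => _ /eqP; rewrite -mulr2n -mulr_natl mulf_eq0 (negPf (two_k k_char)) /= => /eqP ->.
by rewrite scale0r addr0.
Qed.

Lemma unit_y : y \is a GRing.unit.
Proof. by apply: D_div; apply/eqP => -[/eqP]; rewrite oner_eq0. Qed.

Lemma tauyE d : tauy d = Quat a pi (qc0 d) (qc1 d) (- qc2 d) (qc3 d).
Proof.
rewrite tauy_def /conj_by; apply: (canLR (mulrK unit_y)).
by case: d => ????; rewrite !quatopE /=; congr Quat; ring.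
Qed.

Lemma y_tauy d : y * tauy d = conjq d * y.
Proof. by rewrite tauyE; case: d => ????; rewrite !quatopE /=; congr Quat; ring. Qed.

Lemma conj_by_tauy d : conj_by y tauy d = conjq d.
Proof. by rewrite /conj_by y_tauy mulrK ?unit_y. Qed.

Lemma rD_tauy d : O d -> rD (tauy d) = rD d.
Proof.
move=> Od; have Ot : O (tauy d) by move: Od; rewrite tauyE !quat_val_ringE /= val_geN.
by rewrite (rD_coord Ot) (rD_coord Od) tauyE.
Qed.

(** tauy changes the sign of the coordinate on y only, so its skew elements are the
    multiples of y. *)
Lemma tauy_skew d : eps_sym tauy true d <-> exists2 c : K, c != 0 & d = c *: y.
Proof.
rewrite /eps_sym expr1 mulN1r tauyE; split=> [/andP[/eqP]|[c c0 ->]]; last first.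
  apply/andP; split; last first.
    by apply: contraNneq c0 => -[] _ _ /eqP; rewrite mulr1.
  by apply/eqP; rewrite !quatopE /quat_scale /quat_opp /=; congr Quat; ring.
case: d => t0 t1 t2 t3 -[/= /opp_fixed-> /opp_fixed-> /opp_fixed-> d0].
exists t2; last by rewrite scaleqE /quat_scale /=; congr Quat; ring.
by apply: contraNneq d0 => ->.
Qed.

Lemma nuD_skew c : c != 0 -> nuD nu (c *: y) = (nu c)%:~R + 1 / 2%:R.
Proof.
have [pi0 epi] := pi_unif; move=> c0; rewrite /nuD.
have -> : Nrd (c *: y) = - (pi * c ^+ 2) by rewrite /Nrd /=; ring.
rewrite nuN ?mulf_neq0 ?expf_neq0 // Defs.valM ?expf_neq0 // epi expr2 Defs.valM //.
by rewrite !intrD; field.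
Qed.

(** * Lifting isometries *)

Lemma scalar_unit_inv (t : K) : t != 0 -> (t^-1)%:A * t%:A = 1 :> D.
Proof. by move=> t0; rewrite mulr_algl scalerA mulVf // scale1r. Qed.

Lemma conj_scalar (t : K) : Cj t%:A = t%:A.
Proof. by rewrite scaleqE /= /conjq /quat_scale /=; congr Quat; ring. Qed.

Lemma conj_fixed (d : D) : Cj d = d -> d = (qc0 d)%:A.
Proof.
case: d => t0 t1 t2 t3 [].
by move=> /esym/opp_fixed-> /esym/opp_fixed-> /esym/opp_fixed-> /=;
  rewrite scaleqE /quat_scale /=; congr Quat; ring.
Qed.

Lemma diag_mx_recl (R : nzRingType) n (c : nat -> R) :
  diag_mx (\row_(i < 1 + n) c i) =
  block_mx (c 0%N)%:M 0 0 (diag_mx (\row_(i < n) c i.+1)).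
Proof.
apply/matrixP => i j.
case: (split_ordP i) => i' ->; case: (split_ordP j) => j' ->;
  rewrite ?block_mxEul ?block_mxEur ?block_mxEdl ?block_mxEdr !mxE.
- by rewrite !ord1.
- by rewrite [i']ord1.
- by rewrite [j']ord1.
- by [].
Qed.

(** Gram-Schmidt over the valuation ring. Each pivot lies in K and has the same reduction as
    the prescribed entry, so the two differ by a square; clearing a row changes the other
    entries only by elements of the maximal ideal. *)
Lemma hensel_gram n (c : nat -> K) (A : 'M[D]_n) :
  adjmx Cj A = A -> (forall i, (i < n)%N -> val_unit nu (c i)) ->
  (forall i j, O (A i j) /\ rD (A i j) = (redK (c i))%:A *+ (i == j)) ->
  congruent Cj A (diag_mx (\row_(i < n) (c i)%:A)).
Proof.
elim: n => [|n IHn] in c A *.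
  by move=> _ _ _; apply: (@congruent_reindex _ _ _ _ id); [exists id | case].
rewrite -[n.+1]/(1 + n)%N in A * => sA uc cA.
have [t et] : exists t, A 0 0 = t%:A.
  exists (qc0 (A 0 0)); apply: conj_fixed.
  by have /matrixP/(_ 0 0) := sA; rewrite !mxE.
have [Ot rt] := cA 0 0; rewrite et eqxx mulr1n in Ot rt.
have gt : val_ge 0 t by move: Ot; rewrite quat_val_ringE /= mulr1 => /and4P[].
have {}rt : redK t = redK (c 0%N).
  by apply: (fmorph_inj (in_alg E)); rewrite -[LHS]rD_k.
have uc0 := uc 0%N isT.
have ut : val_unit nu t.
  by move: uc0; rewrite !(val_unitE redK_res) gt rt => /andP[].
have t0 : t != 0 by case/andP: ut.
have ulA : ulsubmx A = (t%:A)%:M.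
  by apply: mx11P; rewrite !mxE -et; congr (A _ _); apply: val_inj.
have iA : invertible_mx (ulsubmx A).
  rewrite ulA; apply: invertible_mx11 => //; rewrite mxE mulr1n.
  by rewrite -Nrd_eq0 // /Nrd /= mulr1 !mulr0 expr0n /= !mulr0 !subr0 addr0 expf_neq0.
have sA' : adjmx Cj A = (-1) ^+ false *: A by rewrite expr0 scale1r.
have [m em eM] := block_elimination sA' iA.
have [s s0 es] := hensel_ratio redK_res k_char K_complete uc0 ut (esym rt).
set C := drsubmx A + _ in eM.
have mE i : m i 0 = - (t^-1)%:A * A (rshift 1 i) 0.
  have /matrixP/(_ i 0) := em; rewrite ulA mxE big_ord1 !mxE eqxx mulr1n => e.
  have -> : A (rshift 1 i) 0 = A (rshift 1 i) (lshift n 0).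
    by congr (A _ _); apply: val_inj.
  rewrite mulNr -mulrN -e mulrA.
  have -> : (t^-1)%:A * m i 0 = m i 0 * (t^-1)%:A by rewrite mulr_algl mulr_algr.
  by rewrite -mulrA scalar_unit_inv // mulr1.
have Om i : O (m i 0).
  rewrite mE; apply: O_mul; last by case: (cA (rshift 1 i) 0).
  by apply/O_opp/O_scalar/val_unit_ring/val_unitV.
have CE i j : C i j = A (rshift 1 i) (rshift 1 j) + m i 0 * A 0 (rshift 1 j).
  rewrite mxE [drsubmx A i j]mxE [dsubmx A _ _]mxE; congr (_ + _).
  rewrite mxE big_ord1 !mxE; congr (_ * A _ _); exact: val_inj.
have cC : congruent Cj C (diag_mx (\row_(i < n) (c i.+1)%:A)).
  apply: IHn (fun i => uc i.+1) _.
    have : adjmx Cj (block_mx (ulsubmx A) 0 0 C) = block_mx (ulsubmx A) 0 0 C.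
      by rewrite -eM !adjmxM adjmxK sA mulmxA.
    by rewrite adjmx_block => /eq_block_mx[].
  move=> i j; rewrite CE; have [Oij rij] := cA (rshift 1 i) (rshift 1 j).
  have [O0j r0j] := cA 0 (rshift 1 j); split; first by apply: O_add => //; exact: O_mul.
  rewrite rDD //; last exact: O_mul.
  by rewrite rDM // r0j mulr0n mulr0 addr0 rij eq_rshift.
apply: congruent_trans (_ : congruent Cj A (block_mx (ulsubmx A) 0 0 C)) _.
  apply: congruent_sym; exists (block_mx 1%:M 0 m 1%:M) => //.
  by apply: invertible_block_lower; exact: invertible1.
rewrite (diag_mx_recl n (fun i => (c i)%:A)) ulA; apply: congruent_block cC.
exists (s%:A)%:M.
  exists ((s^-1)%:A)%:M; split; apply: mx11P; rewrite mxE big_ord1 !mxE eqxx !mulr1n.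
    by rewrite mulr_algr scalerA mulVf // scale1r.
  by rewrite mulr_algr scalerA divff // scale1r.
apply: mx11P; rewrite mxE big_ord1 mxE big_ord1 !mxE eqxx !mulr1n conj_scalar es.
by rewrite mulr_algl mulr_algr !scalerA; congr (_ *: _); ring.
Qed.

(** Lift the matrix of the isometry entrywise to P. Then P diag(d) P^* is hermitian with
    reduction diag(c), hence congruent to diag(c); in particular it is invertible, and so
    is P. *)
Lemma lift_congruence n (c d : nat -> K) :
  (forall i, (i < n)%N -> val_unit nu (c i)) -> (forall i, (i < n)%N -> val_unit nu (d i)) ->
  congruent iota (diag_mx (\row_(i < n) ((redK (c i))%:A : E)))
                 (diag_mx (\row_(i < n) ((redK (d i))%:A : E))) ->
  congruent Cj (diag_mx (\row_(i < n) ((c i)%:A : D))) (diag_mx (\row_(i < n) ((d i)%:A : D))).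
Proof.
move=> uc ud [Pb iPb ePb].
have /choice[f fP] : forall e : E, exists u, O u /\ rD u = e.
  by move=> e; have [u Ou <-] := red_surj rD_res e; exists u.
pose P : 'M[D]_n := map_mx f Pb; set Dd := diag_mx (\row_(i < n) ((d i)%:A : D)).
pose A := P *m Dd *m adjmx Cj P.
have gdi (i : 'I_n) : val_ge 0 (d i) by apply/val_unit_ring/ud.
have sDd : adjmx Cj Dd = Dd.
  apply/matrixP => i j; rewrite !mxE eq_sym; case: eqP => [->|_]; last exact: invol0.
  by rewrite !mulr1n conj_scalar.
have cA : congruent Cj A (diag_mx (\row_(i < n) (c i)%:A)).
  apply: hensel_gram => //; first by rewrite /A !adjmxM adjmxK sDd mulmxA.
  move=> i j; have AE : A i j = \sum_l f (Pb i l) * (d l)%:A * conjq (f (Pb j l)).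
    by rewrite mxE mul_mx_diag; apply: eq_bigr => l _; rewrite !mxE.
  have Ol l : O (f (Pb i l) * (d l)%:A * conjq (f (Pb j l))).
    apply: O_mul; [apply: O_mul; [exact: (fP _).1 | exact: O_scalar]|].
    exact/O_conj/(fP _).1.
  rewrite AE; split; first exact: O_sum.
  rewrite rD_sum //; have /matrixP/(_ i j) := ePb.
  rewrite mxE mul_mx_diag !mxE => <-; apply: eq_bigr => l _.
  rewrite !rDM ?O_mul ?O_scalar ?O_conj ?(fP _).1 // !mxE.
  by rewrite rD_conj ?(fP _).1 // !(fP _).2 rD_k // /val_ring; exact: gdi.
have gA : eps_gram Cj false A.
  apply: eps_gram_congr (congruent_sym cA) _.
  pose s := mkseq (fun i => (c i)%:A : D) n.
  have cs : congruent Cj (tagged (diagg s)) (diag_mx (\row_(i < n) (c i)%:A)).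
    apply: congruent_diag_mx; first exact: size_mkseq.
    by move=> i; rewrite nth_mkseq.
  apply: eps_gram_congr cs _; apply/eps_gram_diag => //.
  apply/allP => e /mapP[i]; rewrite mem_iota add0n => /andP[_ ni] ->.
  rewrite /eps_sym conj_scalar expr0 mul1r eqxx /=.
  have /andP[ci0 _] := uc i ni.
  by rewrite -Nrd_eq0 // /Nrd /= mulr1 !mulr0 expr0n /= !mulr0 !subr0 addr0 expf_neq0.
apply: congruent_trans (congruent_sym cA) _; exists P => //.
have [B [AB BA]] := gA.2.
have PQ : P *m (Dd *m adjmx Cj P *m B) = 1%:M by rewrite !mulmxA.
by exists (Dd *m adjmx Cj P *m B); split=> //; exact: mulmx1_divC.
Qed.

Definition skew_diag (s : seq K) : seq D := [seq c *: y | c <- s].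
Definition residue_diag (s : seq K) : seq E := [seq (redK c)%:A | c <- s].

(** y tauy(p) = conj(p) y turns the adjoint for the canonical involution into the adjoint
    for tauy. *)
Lemma congruent_twist n (A B : 'M[D]_n) : congruent Cj A B ->
  congruent tauy (A *m diag_mx (const_mx y)) (B *m diag_mx (const_mx y)).
Proof.
case=> P iP <-; exists P => //; rewrite -!mulmxA; congr (_ *m (_ *m _)).
rewrite mul_mx_diag mul_diag_mx; apply/matrixP => i j; rewrite !mxE.
exact: y_tauy.
Qed.

Lemma lift_isometry (s t : seq K) : all (val_unit nu) s -> all (val_unit nu) t ->
  congruent iota (diagm (residue_diag s)) (diagm (residue_diag t)) ->
  congruent tauy (diagm (skew_diag s)) (diagm (skew_diag t)).
Proof.
move=> us ut cst.
(* Over the field E, invertible matrices are square. *)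
have sz : size s = size t.
  have [P [Q [PQ QP]] _] := cst; have := mulmx1_min PQ; have := mulmx1_min QP.
  by rewrite /= !size_map => st ts; apply/eqP; rewrite eqn_leq st ts.
have cE (r : seq K) n : size r = n -> congruent iota (diagm (residue_diag r))
    (diag_mx (\row_(i < n) ((redK r`_i)%:A : E))).
  move=> er; apply: congruent_diag_mx; first by rewrite size_map.
  by move=> i; rewrite (nth_map 0) // er.
have cD (r : seq K) n : size r = n -> congruent tauy (diagm (skew_diag r))
    (diag_mx (\row_(i < n) ((r`_i)%:A : D)) *m diag_mx (const_mx y)).
  move=> er.
  have -> : diag_mx (\row_(i < n) ((r`_i)%:A : D)) *m diag_mx (const_mx y) =
      diag_mx (\row_(i < n) (r`_i *: y)).
    rewrite mulmx_diag; congr diag_mx; apply/rowP => i; rewrite !mxE.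
    by rewrite mulr_algl.
  apply: congruent_diag_mx; first by rewrite size_map.
  by move=> i; rewrite (nth_map 0) // er.
apply: congruent_trans (cD s (size t) sz) _.
apply: congruent_trans _ (congruent_sym (cD t (size t) erefl)).
apply/congruent_twist/lift_congruence.
- by move=> i it; apply: (allP us); rewrite mem_nth ?sz.
- by move=> i it; apply: (allP ut); rewrite mem_nth.
apply: congruent_trans (congruent_sym (cE s (size t) sz)) _.
exact: congruent_trans cst (cE t (size t) erefl).
Qed.

(** * Diagonal skew-hermitian forms and their residues *)

(** The equation is that the sum of the c_i Nrd(v_i) vanishes. It is kept when v is divided
    by its coordinate of least valuation, after which v reduces to a nonzero vector. *)
Lemma residue_isotropic (s : seq K) (v : 'rV[D]_(size (skew_diag s))) :
  all (val_unit nu) s -> v != 0 ->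
  v *m diagm (skew_diag s) *m adjmx tauy v = 0 ->
  exists2 w : 'rV[E]_(size (residue_diag s)), w != 0 &
    w *m diagm (residue_diag s) *m adjmx iota w = 0.
Proof.
move=> us v0 vv; have szs : size (skew_diag s) = size s by rewrite size_map.
have szr : size (residue_diag s) = size s by rewrite size_map.
have [i1 vi1] : exists i, v 0 i != 0.
  apply/existsP; apply: contra_neqT v0; rewrite negb_exists => /forallP z.
  by apply/rowP => i; rewrite [RHS]mxE; apply/eqP/negPn; exact: z.
case: (arg_minP (P := fun i => v 0 i != 0) (fun i => nu (Nrd (v 0 i))) vi1) => i0 vi0 min0.
have sumv : \sum_(i < size (skew_diag s)) s`_i * Nrd (v 0 i) = 0.
  have /matrixP/(_ 0 0) := vv; rewrite mul_mx_diag !mxE.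
  rewrite (eq_bigr (fun i : 'I_(size (skew_diag s)) => (s`_i * Nrd (v 0 i)) *: y)) => [|i _].
    by rewrite -scaler_suml => /(congr1 (@qc2 _ _ _)) /=; rewrite mulr1.
  rewrite !mxE (nth_map 0) -?szs // -scalerAr -scalerAl -mulrA y_tauy.
  by rewrite mulrA mulq_conj -scalerAl mul1r scalerA.
pose u : D := (v 0 i0)^-1; pose w (i : 'I_(size (skew_diag s))) := u * v 0 i.
have Ow i : O (w i).
  rewrite quat_val_ring_Nrd NrdM.
  have [->|vi] := eqVneq (v 0 i) 0.
    by rewrite (_ : Nrd 0 = 0) ?mulr0 ?val_ge0 //; rewrite /Nrd /=; ring.
  have N0 : Nrd (v 0 i0) != 0 by rewrite Nrd_eq0.
  have Nu : Nrd u * Nrd (v 0 i0) = 1 by rewrite -NrdM mulVr ?D_div // Nrd1.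
  have -> : Nrd u = (Nrd (v 0 i0))^-1 by rewrite -[RHS]mul1r -Nu mulfK.
  have Ni : Nrd (v 0 i) != 0 by rewrite Nrd_eq0.
  rewrite val_geE ?mulf_neq0 ?invr_eq0 // Defs.valM ?invr_eq0 // nuV //.
  by rewrite addrC subr_ge0 min0.
have sumw : \sum_(i < size (skew_diag s)) s`_i * Nrd (w i) = 0.
  rewrite (eq_bigr (fun i : 'I_(size (skew_diag s)) => Nrd u * (s`_i * Nrd (v 0 i)))) => [|i _].
    by rewrite -mulr_sumr sumv mulr0.
  by rewrite NrdM mulrCA.
have wi0 : w i0 = 1 by rewrite /w /u mulVr ?D_div.
clearbody w; have e : size (residue_diag s) = size (skew_diag s) by rewrite szs szr.
exists (\row_j rD (w (cast_ord e j))).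
  apply/eqP => /rowP/(_ (cast_ord (esym e) i0)); rewrite !mxE cast_ordKV wi0.
  by rewrite (red1 rD_res) => /eqP; rewrite oner_eq0.
apply/matrixP => i j; rewrite !ord1 mul_mx_diag !mxE.
have Os (l : 'I_(size (skew_diag s))) : O (w l * (s`_l)%:A * conjq (w l)).
  apply: O_mul; last exact/O_conj/Ow.
  apply: O_mul; [exact: Ow | apply/O_scalar/val_unit_ring/(allP us)/mem_nth].
  by rewrite -szs.
transitivity (rD (\sum_(l < size (skew_diag s)) w l * (s`_l)%:A * conjq (w l))).
  rewrite rD_sum // (reindex (cast_ord e)) /=; last first.
    by exists (cast_ord (esym e)) => l _; rewrite ?cast_ordK ?cast_ordKV.
  apply: eq_bigr => l _; rewrite !mxE (nth_map 0) -?szr //.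
  have gl : val_ge 0 s`_l by apply/val_unit_ring/(allP us)/mem_nth; rewrite -szr.
  have Ol : O (s`_l)%:A by exact: O_scalar.
  rewrite !rDM ?Ow ?O_conj ?O_mul ?Ow //.
  by rewrite rD_conj ?Ow // rD_k.
rewrite (eq_bigr (fun l : 'I_(size (skew_diag s)) => (s`_l * Nrd (w l))%:A)) => [|l _].
  by rewrite -scaler_suml sumw scale0r rD0.
by rewrite mulr_algr -scalerAl mulq_conj scalerA.
Qed.

Lemma skew_diag_sym s : all (val_unit nu) s -> all (eps_sym tauy true) (skew_diag s).
Proof.
move=> us; apply/allP => d /mapP[c cs ->]; apply/tauy_skew.
by exists c => //; have /andP[] := allP us _ cs.
Qed.

Lemma residue_diag_sym s : all (val_unit nu) s -> all (eps_sym iota false) (residue_diag s).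
Proof.
move=> us; apply/allP => d /mapP[c cs ->]; rewrite /eps_sym iota_k expr0 mul1r eqxx /=.
have := allP us _ cs; rewrite (val_unitE redK_res) => /andP[_].
by rewrite -(fmorph_eq0 (in_alg E)).
Qed.

(** Since r (c' y) tauy(r) is p^2 c' y for r = p in K, and - p^2 pi c' y for r = p y, both
    parities of the valuation of c can be reduced to 0. *)
Lemma skew_normalization c : c != 0 ->
  exists c' (r : D), [/\ val_unit nu c', r != 0 & r * (c' *: y) * tauy r = c *: y].
Proof.
have [pi0 epi] := pi_unif; move=> c0.
have [p p0 ep] : exists2 p, p != 0 & nu p = (nu c %/ 2)%Z.
  exists (pi ^ (nu c %/ 2)%Z); first exact: expfz_neq0.
  case: (nu c %/ 2)%Z => n; first by rewrite -exprnP nuX // epi mulr1.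
  by rewrite NegzE -exprz_inv -exprnP exprVn nuV ?expf_neq0 // nuX // epi mulr1.
have [nu2|nu2] : nu c = nu p + nu p \/ nu c = nu p + nu p + 1 by rewrite ep; lia.
  exists (c / (p * p)), p%:A; split.
  - rewrite /val_unit !mulf_neq0 ?invr_eq0 ?mulf_neq0 //=.
    by rewrite Defs.valM ?invr_eq0 ?mulf_neq0 // nuV ?mulf_neq0 // Defs.valM //; lia.
  - by apply: contraNneq p0 => -[/eqP]; rewrite mulr1.
  - rewrite tauyE !quatopE /quat_scale /=; congr Quat; field => //.
exists (- (c / (p * p * pi))), (p *: y); split.
- rewrite val_unitN /val_unit !mulf_neq0 ?invr_eq0 ?mulf_neq0 //=.
  by rewrite Defs.valM ?invr_eq0 ?mulf_neq0 // nuV ?mulf_neq0 // !Defs.valM ?mulf_neq0 //; lia.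
- by apply: contraNneq p0 => -[_ _ /eqP]; rewrite mulr1.
- rewrite tauyE !quatopE /quat_scale /=; congr Quat; by field; rewrite p0 pi0.
Qed.

Lemma skew_diag_normalization (ds : seq D) : all (eps_sym tauy true) ds ->
  exists s, [/\ all (val_unit nu) s, size s = size ds &
    congruent tauy (diagm ds) (diagm (skew_diag s))].
Proof.
elim: ds => [_|d ds IHs /= /andP[ed es]].
  by exists [::]; split=> //; exact: congruent_refl.
have [s [us sz cs]] := IHs es.
have [c c0 ->] : exists2 c : K, c != 0 & d = c *: y.
  exact/tauy_skew.
have [c' [r [uc' r0 er]]] := skew_normalization c0.
exists (c' :: s); split=> /=; [by rewrite uc' | by rewrite sz |].
apply: congruent_trans (diagg_cons_congruent _ _ _) _.
apply: congruent_trans _ (congruent_sym (diagg_cons_congruent _ _ _)).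
apply: congruent_block cs; exists r%:M.
  by apply: invertible_mx11 => //; rewrite mxE eqxx mulr1n.
by apply: mx11P; rewrite mxE big_ord1 mxE big_ord1 !mxE eqxx !mulr1n er.
Qed.

(** * The Witt groups *)

Local Notation skew_class s := (diag_class tauy true (skew_diag s)).
Local Notation residue_class s := (diag_class iota false (residue_diag s)).

Lemma skew_sym_y : eps_sym tauy true y.
Proof.
by apply/tauy_skew; exists 1; rewrite ?oner_neq0 ?scale1r.
Qed.

Lemma all_val_unitN s : all (val_unit nu) s -> all (val_unit nu) [seq - c | c <- s].
Proof. by rewrite all_map; apply: sub_all => c /=; rewrite val_unitN. Qed.

Lemma skew_class_surj (w : witt tauy true) :
  exists2 s, all (val_unit nu) s & w = skew_class s.
Proof.
rewrite -(witt_reprK w) -gram_classE; have gA := formP (repr w).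
have [ds [_ eds c]] := diagonalization D_div two_D skew_sym_y gA.
have [s [us _ cs]] := skew_diag_normalization eds.
by exists s => //; apply: gram_class_congruent gA (congruent_trans c cs).
Qed.

(** The symmetric elements of iota are those of k, which lift to K. *)
Lemma residue_diagonalization n (A : 'M[E]_n) : eps_gram iota false A ->
  exists s, [/\ all (val_unit nu) s, size s = n &
    congruent iota A (diagm (residue_diag s))].
Proof.
move=> gA; have e1 : eps_sym iota false 1 by exact: eps_sym1.
have [ds [sz eds c]] := diagonalization (@field_division E) two_E e1 gA.
suff [s us es] : exists2 s, all (val_unit nu) s & ds = residue_diag s.
  by exists s; split=> //; [rewrite -sz es size_map | rewrite -es].
elim: ds eds {sz c} => [_|d ds IHs /= /andP[/andP[/eqP ed d0] /IHs[s us ->]]].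
  by exists [::].
have [c ec] : exists c : k, d = c%:A.
  by apply: iota_fixed; rewrite ed expr0 mul1r.
have [|t ut et] := redK_lift_unit redK_res (r := c).
  by apply: contraNneq d0 => c0; rewrite ec c0 scale0r.
by exists (t :: s); rewrite /= ?ut // et ec.
Qed.

Lemma residue_diag_hyp r : residue_diag (hyp 1 r) = hyp 1 r.
Proof.
rewrite /residue_diag map_cat !map_nseq (redKN redK_res) ?val_ge1 // (redK1 redK_res).
by rewrite scaleNr scale1r.
Qed.

Lemma skew_diag_hyp r : skew_diag (hyp 1 r) = hyp y r.
Proof. by rewrite /skew_diag map_cat !map_nseq scaleNr scale1r. Qed.

Lemma skew_classB s t : all (val_unit nu) s -> all (val_unit nu) t ->
  skew_class (s ++ [seq - c | c <- t]) = skew_class s - skew_class t.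
Proof.
move=> us ut; have ut' := all_val_unitN ut.
rewrite -(diag_classN D_div) ?skew_diag_sym // -(diag_class_cat D_div) ?skew_diag_sym //.
  rewrite /skew_diag map_cat -!map_comp; congr (diag_class _ _ (_ ++ _)).
  by apply: eq_map => c; rewrite /= scaleNr.
have := skew_diag_sym ut'; rewrite /skew_diag -!map_comp.
by congr (all _ _); apply: eq_map => c; rewrite /= scaleNr.
Qed.

Lemma residue_diagN t : all (val_unit nu) t ->
  residue_diag [seq - c | c <- t] = [seq - e | e <- residue_diag t].
Proof.
move=> ut; rewrite /residue_diag -!map_comp; apply/eq_in_map => c ct /=.
by rewrite (redKN redK_res) ?scaleNr //; exact/val_unit_ring/(allP ut).
Qed.

Lemma residue_classB s t : all (val_unit nu) s -> all (val_unit nu) t ->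
  residue_class (s ++ [seq - c | c <- t]) = residue_class s - residue_class t.
Proof.
move=> us ut; have ut' := all_val_unitN ut.
have -> : residue_diag (s ++ [seq - c | c <- t]) =
    residue_diag s ++ residue_diag [seq - c | c <- t] by exact: map_cat.
rewrite (diag_class_cat (@field_division E)) ?residue_diag_sym //.
by rewrite residue_diagN // (diag_classN (@field_division E)) ?residue_diag_sym.
Qed.

(** By Witt cancellation over E the residue form is isometric to a sum of planes <-1, 1>,
    and this isometry lifts to D. *)
Lemma residue_class0 s : all (val_unit nu) s -> residue_class s = 0 -> skew_class s = 0.
Proof.
move=> us; have gs := diag_axiom (@field_division E) (residue_diag_sym us).
have e1 : eps_sym iota false 1 by exact: eps_sym1.
move/(witt_zero_hyp (@field_division E) two_E e1) => [r].
rewrite insub_gram // -residue_diag_hyp => c.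
have u1 : val_unit nu 1 by rewrite /val_unit oner_neq0 nu1.
have uh : all (val_unit nu) (hyp 1 r).
  by rewrite all_cat !all_nseq val_unitN u1 !orbT.
have := lift_isometry us uh c.
rewrite skew_diag_hyp => ch.
have gy := diag_axiom D_div (skew_diag_sym us).
by rewrite [LHS](gram_class_congruent gy ch); exact: diag_class_hyp skew_sym_y.
Qed.

(** By Witt cancellation over D the form is hyperbolic. Unless it is 0, it is isotropic, and
    so is its residue, which is therefore Witt equivalent to a shorter form. A lift of the
    latter is again Witt trivial, as the Witt equivalence lifts, and induction applies. *)
Lemma skew_class0 s : all (val_unit nu) s -> skew_class s = 0 -> residue_class s = 0.
Proof.
elim: {s}(size s).+1 {-2}s (ltnSn (size s)) => // N IHN s lenN us s0.
have gr := diag_axiom (@field_division E) (residue_diag_sym us).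
have gy := diag_axiom D_div (skew_diag_sym us).
have [/size0nil ->|sn0] := eqVneq (size s) 0%N.
  exact: (@diag_class_hyp E (@field_division E) iota false 1 0 (eps_sym1 _)).
have [r] := witt_zero_hyp D_div two_D skew_sym_y s0.
move/hyp_isotropic; rewrite /form_dim insub_gram //.
case=> [|v v0 vv]; first by rewrite /= size_map.
have [w w0 ww] := residue_isotropic us v0 vv.
have [m [C [ltm gC eC]]] := isotropic_reduction (@field_division E) two_E gr w0 ww.
have [t [ut szt ct]] := residue_diagonalization gC.
have est : residue_class s = residue_class t.
  rewrite [LHS]eC.
  exact: (@gram_class_congruent E iota false (Tagged (fun n => 'M[E]_n) C) (diagg _) gC ct).
rewrite est; apply: IHN => //.
  by rewrite szt; move: ltm; rewrite /= size_map; lia.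
have ust : all (val_unit nu) (s ++ [seq - c | c <- t]) by rewrite all_cat us all_val_unitN.
have := residue_class0 ust; rewrite residue_classB // est subrr => /(_ erefl).
by rewrite skew_classB // s0 sub0r => /eqP; rewrite oppr_eq0 => /eqP.
Qed.

Lemma skew_class_inj s t : all (val_unit nu) s -> all (val_unit nu) t ->
  skew_class s = skew_class t <-> residue_class s = residue_class t.
Proof.
move=> us ut.
have ust : all (val_unit nu) (s ++ [seq - c | c <- t]) by rewrite all_cat us all_val_unitN.
split=> e; apply/eqP; rewrite -subr_eq0; apply/eqP.
  by rewrite -residue_classB //; apply: skew_class0 => //; rewrite skew_classB // e subrr.
by rewrite -skew_classB //; apply: residue_class0 => //; rewrite residue_classB // e subrr.
Qed.

Lemma residue_class_surj (w : witt iota false) :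
  exists2 s, all (val_unit nu) s & w = residue_class s.
Proof.
rewrite -(witt_reprK w) -gram_classE; have gA := formP (repr w).
have [s [us _ cs]] := residue_diagonalization gA.
exists s => //.
exact: (@gram_class_congruent E iota false (form_gram (repr w)) (diagg (residue_diag s)) gA cs).
Qed.

(** Lists of units of K map onto both Witt groups, with the same fibres by skew_class_inj;
    this defines the isomorphism and its inverse. *)
Lemma residue_isomorphism : exists d1 : {additive witt tauy true -> witt iota false},
  bijective d1 /\ forall s, all (val_unit nu) s -> d1 (skew_class s) = residue_class s.
Proof.
have /choice[S SP] : forall w : witt tauy true,
    exists s, all (val_unit nu) s /\ w = skew_class s.
  by move=> w; have [s us ->] := skew_class_surj w; exists s.
have /choice[R RP] : forall w : witt iota false,
    exists s, all (val_unit nu) s /\ w = residue_class s.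
  by move=> w; have [s us ->] := residue_class_surj w; exists s.
pose f w := residue_class (S w).
have fE s : all (val_unit nu) s -> f (skew_class s) = residue_class s.
  move=> us; have [us' es] := SP (skew_class s).
  by apply/(skew_class_inj us' us); rewrite -es.
have fB : zmod_morphism f.
  move=> v w; have [uv ev] := SP v; have [uw ew] := SP w.
  rewrite [in LHS]ev [in X in f (_ - X)]ew -skew_classB // fE; last first.
    by rewrite all_cat uv all_val_unitN.
  exact: residue_classB.
pose fA := GRing.isZmodMorphism.Build _ _ f fB.
pose d1 : {additive witt tauy true -> witt iota false} := HB.pack f fA.
exists d1; split=> //; exists (fun w => skew_class (R w)) => w /=.
  have [uw ew] := SP w; have [uf ef] := RP (f w).
  by rewrite [RHS]ew; apply/(skew_class_inj uf uw); rewrite -ef.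
by have [uw ew] := RP w; rewrite fE.
Qed.

Lemma skew_form_diagonal (h : epsform tauy true) : exists s,
  [/\ all (val_unit nu) s, size s = form_dim h & congruent tauy (tagged h) (diagm (skew_diag s))].
Proof.
have [ds [sz eds c]] := diagonalization D_div two_D skew_sym_y (formP h).
have [s [us szs cs]] := skew_diag_normalization eds.
by exists s; split=> //; [rewrite szs | exact: congruent_trans c cs].
Qed.

Lemma skew_diag_form s : all (val_unit nu) s ->
  exists h : epsform tauy true, form_gram h = diagg (skew_diag s).
Proof.
by move=> us; exists (mkform (diag_axiom D_div (skew_diag_sym us))).
Qed.

Lemma residue_diag_form s : all (val_unit nu) s ->
  exists g : epsform iota false, form_gram g = diagg (residue_diag s).
Proof.
by move=> us; exists (mkform (diag_axiom (@field_division E) (residue_diag_sym us))).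
Qed.

Lemma nuD_skew_diag s d : all (val_unit nu) s -> d \in skew_diag s -> nuD nu d = 1 / 2%:R.
Proof.
move=> us /mapP[c cs ->]; have /andP[c0 /eqP ec] := allP us _ cs.
by rewrite nuD_skew // ec add0r.
Qed.

Lemma skew_form_ramified (h : epsform tauy true) : ramified nu h.
Proof.
have [s [us _ c]] := skew_form_diagonal h; have [h1 e1] := skew_diag_form us.
exists (skew_diag s), h1; split=> // [d|]; first exact: nuD_skew_diag.
by rewrite /isometric e1.
Qed.

(** The valuation of c y is nu(c) + 1/2, never 0. *)
Lemma no_skew_unit (u : seq D) : all (eps_sym tauy true) u ->
  (forall d, d \in u -> nuD nu d = 0) -> u = [::].
Proof.
case: u => // d u /andP[ed _] /(_ d (mem_head _ _)).
have [c c0 ->] : exists2 c : K, c != 0 & d = c *: y.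
  exact/tauy_skew.
rewrite nuD_skew // => e; exfalso.
have {}e : ((nu c + nu c + 1)%:~R : rat) = 0 by rewrite !intrD; move: e; lra.
by move/eqP: e; rewrite intr_eq0; lia.
Qed.

Lemma skew_half (v : seq D) : all (eps_sym tauy true) v ->
  (forall d, d \in v -> nuD nu d = 1 / 2%:R) ->
  exists2 s, all (val_unit nu) s & v = skew_diag s.
Proof.
elim: v => [|d v IHv] /=; first by exists [::].
case/andP=> ed ev hv; have [|s us ->] := IHv ev.
  by move=> e ve; apply: hv; rewrite inE ve orbT.
have [c c0 e] : exists2 c : K, c != 0 & d = c *: y.
  exact/tauy_skew.
exists (c :: s); last by rewrite e.
rewrite /= us andbT /val_unit c0 /=; have := hv d (mem_head _ _).
rewrite e nuD_skew // => h.
have : ((nu c)%:~R : rat) == 0 by apply/eqP; move: h; lra.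
by rewrite intr_eq0.
Qed.

(** The summand h0 is 0 and the entries of h1 are of the form c y with c a unit, so that the
    residue map is already prescribed by its values on skew_diag s. *)
Lemma larmour_residues_ramified (d0 : witt tauy true -> witt (id_involution E) true)
    (d1 : witt tauy true -> witt iota false) :
  (forall s, all (val_unit nu) s -> d1 (skew_class s) = residue_class s) ->
  larmour_residues nu y rD d0 d1.
Proof.
move=> d1E u v h h0 h1 nu_u nu_v e0 e1 hh.
have g0 := formP h0; have g1 := formP h1; rewrite e0 in g0; rewrite e1 in g1.
have eu : u = [::].
  by apply: no_skew_unit nu_u; apply/(eps_gram_diag D_div).
have [s us ev] : exists2 s, all (val_unit nu) s & v = skew_diag s.
  by apply: skew_half nu_v; apply/(eps_gram_diag D_div).
split.
  exists (mkform (diag_axiom (@field_division E)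
      (isT : all (eps_sym (id_involution E) true) [::]))).
    by rewrite eu.
  by rewrite (witt_alternating two_E (d0 _)) (witt_alternating two_E (witt_class _)).
have [g eg] := residue_diag_form us; exists g.
  rewrite eg ev /residue_diag /skew_diag -map_comp; congr diagg; apply/eq_in_map => c cs /=.
  by rewrite -scalerAl mulrV ?unit_y // rD_k //; exact/val_unit_ring/(allP us).
have -> : witt_class h = skew_class s.
  rewrite (witt_isometric hh) -gram_classE /= gram_class_sum ?e0 ?e1 // eu -ev.
  have -> : gram_class tauy true (diagg [::]) = 0.
    exact: (@diag_class_hyp D D_div tauy true y 0 skew_sym_y).
  by rewrite add0r.
by rewrite d1E // -gram_classE eg.
Qed.

End Larmour.

Theorem mainTheorem14
  (* K, complete discretely valued, with residue field k of characteristic not 2 *)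
  (K : fieldType) (nu : normalized_valuation K) (K_complete : complete_valuation nu)
  (k : fieldType) (redK : K -> k)
  (redK_res : residue_map (val_ring nu) (val_ideal nu) redK)
  (k_char : 2%N \notin [pchar k])
  (* D = (a, pi / K) is a division algebra *)
  (a pi : K) (a_unit : val_unit nu a) (pi_unif : pi != 0 /\ nu pi = 1)
  (D_div : is_division_ring (quaternion a pi))
  (* E is the residue field of D, an extension of k *)
  (E : fieldExtType k) (redD : quaternion a pi -> E)
  (redD_res : residue_map (@quat_val_ring K nu a pi) (@quat_val_ideal K nu a pi) redD)
  (redD_k : forall c : K, val_ring nu c -> redD c%:A = (redK c)%:A)
  (* iota is the nontrivial k-automorphism of E *)
  (iota : involution E)
  (iota_k : forall c : k, iota c%:A = c%:A) (iota_nontriv : exists e : E, iota e <> e)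
  (* tauy is tau_y *)
  (tauy : involution (quaternion a pi))
  (tauy_def : forall d, tauy d = conj_by (qy a pi) (canonical_involution a pi) d) :
  [/\ (* E = k(xbar), quadratic over k, with xbar^2 = abar *)
      [/\ \dim {:E} = 2%N, <<1%VS; redD (qx a pi)>>%VS = fullv
        & redD (qx a pi) ^+ 2 = (redK a)%:A],
      (* y is a skew-symmetric uniformizer, with the expected twisted and residual
         involutions *)
      [/\ tauy (qy a pi) = - qy a pi,
          nuD nu (qy a pi) = 1 / 2%:R,
          forall d, conj_by (qy a pi) tauy d = canonical_involution a pi d,
          forall d, quat_val_ring nu d -> redD (canonical_involution a pi d) = iota (redD d)
        & forall d, quat_val_ring nu d -> redD (tauy d) = id_involution E (redD d)],
      (* every skew-hermitian form is ramified *)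
      forall h : epsform tauy true, ramified nu h,
      (* one-dimensional forms *)
      forall h : epsform tauy true, form_dim h = 1%N ->
        exists (beta : K) (h' : epsform tauy true),
          [/\ val_unit nu beta, form_gram h' = diagg [:: beta *: qy a pi]
            & isometric h h']
    & (* Larmour's isomorphism *)
      (forall w : witt (id_involution E) true, w = 0) /\
      exists (d0 : {additive witt tauy true -> witt (id_involution E) true})
             (d1 : {additive witt tauy true -> witt iota false}),
        [/\ larmour_residues nu (qy a pi) redD d0 d1,
            bijective d1
          & forall beta : K, val_unit nu beta ->
              exists (h : epsform tauy true) (g : epsform iota false),
                [/\ form_gram h = diagg [:: beta *: qy a pi],
                    form_gram g = diagg [:: (redK beta)%:A]
                  & d1 (witt_class h) = witt_class g]]].
Proof.
split.
- split.
  + exact: (E_dim K_complete redK_res k_char a_unit pi_unif D_div redD_res redD_k).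
  + exact: (E_adjoin K_complete redK_res k_char a_unit pi_unif D_div redD_res redD_k).
  + exact: (rDx_sqr K_complete redK_res k_char a_unit pi_unif D_div redD_res redD_k).
- split.
  + rewrite (tauyE D_div tauy_def) !quatopE /quat_opp /=; congr Quat; ring.
  + have := nuD_skew a pi_unif (oner_neq0 K); rewrite scale1r nu1 add0r; exact.
  + exact: (conj_by_tauy D_div tauy_def).
  + move=> d; exact: (rD_conj K_complete redK_res k_char a_unit pi_unif D_div redD_res redD_k
      iota_k iota_nontriv).
  + move=> d; exact: (rD_tauy K_complete redK_res k_char a_unit pi_unif D_div redD_res redD_k
      tauy_def).
- exact: (skew_form_ramified redK_res k_char a_unit pi_unif D_div tauy_def).
- move=> h h1; have [s [us sz c]] := skew_form_diagonal redK_res k_char a_unit pi_unif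
    D_div tauy_def h.
  have [h' eh'] := skew_diag_form redK_res k_char D_div tauy_def us.
  case: s us sz c eh' => [|beta [|? ?]] /= us sz c eh'; try by rewrite h1 in sz.
  exists beta, h'; split=> //; first by case/andP: us.
  by rewrite /isometric eh'.
split; first exact: (witt_alternating (two_E k_char E)).
have [d1 [bd1 d1E]] := residue_isomorphism K_complete redK_res k_char a_unit pi_unif D_div
  redD_res redD_k iota_k iota_nontriv tauy_def.
exists (\0 : {additive witt tauy true -> witt (id_involution E) true}), d1; split=> //.
  exact: (larmour_residues_ramified redK_res k_char a_unit pi_unif D_div redD_k iota_k tauy_def).
move=> beta ub; have us : all (val_unit nu) [:: beta] by rewrite /= ub.
have [h eh] := skew_diag_form redK_res k_char D_div tauy_def us.
have [g eg] := residue_diag_form redK_res iota_k us.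
exists h, g; split=> //.
by rewrite -!gram_classE eh eg; exact: d1E.
Qed.
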